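(* Let $\mu$ be the plate process on $Y$ with density $p(x)=c_\nu^{-1}\exp(\nu_1S(U_x)+\nu_2L(U_x)+\nu_3N(U_x))$ with respect to $P_\eta$, where $\nu_1\in\mathbb R$, $\nu_2\le0$, $\nu_3\le0$. Then $$\mathbb E S(U_\mu)=\int_Y\mathbb E[\mathcal E_\mu(y)]A(y)\,\lambda(dy),\quad \mathbb EL(U_\mu)=\tfrac12\int_{Y^2}\mathbb E[\mathcal E_\mu(y_1,y_2)]\,l(y_1\cap y_2)\,\lambda(d(y_1,y_2)),$$ $$\mathbb EN(U_\mu)=\tfrac16\int_{Y^3}\mathbb E[\mathcal E_\mu(y_1,y_2,y_3)]1_{[y_1\cap y_2\cap y_3\neq\emptyset]}\lambda(d(y_1,y_2,y_3)),$$ $$\mathbb E[S(U_\mu)^2]=\int_{Y^2}\mathbb E[\mathcal E_\mu(y_1,y_2)]A(y_1)A(y_2)\lambda(d(y_1,y_2))+\int_Y\mathbb E[\mathcal E_\mu(y)]A(y)^2\lambda(dy),$$ $$\mathbb E[L(U_\mu)^2]=\tfrac14\int_{Y^4}\mathbb E[\mathcal E_\mu(y_1,\dots,y_4)]l(y_1\cap y_2)l(y_3\cap y_4)\lambda(d(y_1,\dots,y_4))+\int_{Y^3}\mathbb E[\mathcal E_\mu(y_1,y_2,y_3)]l(y_1\cap y_2)l(y_3\cap y_1)\lambda(d(y_1,y_2,y_3))+\tfrac12\int_{Y^2}\mathbb E[\mathcal E_\mu(y_1,y_2)]l(y_1\cap y_2)^2\lambda(d(y_1,y_2)),$$ $$\mathbb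 E[N(U_\mu)^2]=\tfrac1{36}\int_{Y^6}\mathbb E[\mathcal E_\mu(y_1,\dots,y_6)]1_{[y_1\cap y_2\cap y_3\neq\emptyset]}1_{[y_4\cap y_5\cap y_6\neq\emptyset]}\lambda(d(y_1,\dots,y_6))+\tfrac14\int_{Y^5}\mathbb E[\mathcal E_\mu(y_1,\dots,y_5)]1_{[y_1\cap y_2\cap y_3\neq\emptyset]}1_{[y_4\cap y_5\cap y_1\neq\emptyset]}\lambda(d(y_1,\dots,y_5))$$ $$+\tfrac12\int_{Y^4}\mathbb E[\mathcal E_\mu(y_1,\dots,y_4)]1_{[y_1\cap y_2\cap y_3\neq\emptyset]}1_{[y_4\cap y_2\cap y_1\neq\emptyset]}\lambda(d(y_1,\dots,y_4))+\tfrac16\int_{Y^3}\mathbb E[\mathcal E_\mu(y_1,y_2,y_3)]1_{[y_1\cap y_2\cap y_3\neq\emptyset]}\lambda(d(y_1,y_2,y_3)).$$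
   Context: $B\subset\mathbb R^3$ is a bounded Borel set with positive volume, $b>0$, $\mathbb S^2$ the unit (upper) hemisphere, $Y=B\times(0,b]\times\mathbb S^2$; $y=(z,r,\phi)\in Y$ represents the closed disc in $\mathbb R^3$ with centre $z$, radius $r$, unit normal $\phi$. $\eta$ is a Poisson process on $Y$ with intensity measure $\lambda(d(z,r,\phi))=\rho(z)\,dz\,Q(dr)\,V(d\phi)$, $\rho$ bounded nonnegative on $B$, $Q,V$ probability measures; $\lambda(d(y_1,\dots,y_n))$ denotes $\lambda^n$. For a finite configuration $x$ of plates: $A(s)=\pi r^2$ the area of plate $s$, $l(s\cap t)$ the length of the intersection of plates $s,t$; $S(U_x)=\sum_{s\in x}A(s)$, $L(U_x)=\frac12\sum_{(s,t)\in x^2_{\neq}}l(s\cap t)$, $N(U_x)=\frac16\sum_{(s,t,u)\in x^3_{\neq}}1_{[s\cap t\cap u\neq\emptyset]}$ ($x^k_{\neq}$ = $k$-tuples of distinct plates of $x$); $G(U_x)=(S,L,N)(U_x)$, $\nu=(\nu_1,\nu_2,\nu_3)$, $c_\nu$ the normalizing constant. For $y,y_i\notin x$: $D_yG(U_x)=\big(A(y),\ \sum_{s\in x}l(s\cap y),\ \#\{\{s,t\}\subset x,\ s\neq t: s\cap t\cap y\neq\emptyset\}\big)$, $D^2_{y_1y_2}G(U_x)=\big(0,\ l(y_1\cap y_2),\ \sum_{s\in x}1_{[s\cap y_1\cap y_2\neq\emptyset]}\big)$, $D^3_{y_1y_2y_3}G(U_x)=(0,0,1_{[y_1\cap y_2\cap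 y_3\neq\emptyset]})$. $\mathcal E_x(y_1,\dots,y_m)=\exp(\nu\cdot Q_m)$, $Q_m=\sum_{i}D_{y_i}G(U_x)+\sum_{i<j}D^2_{y_iy_j}G(U_x)+\sum_{i<j<l}D^3_{y_iy_jy_l}G(U_x)$; $\mathcal E_\mu$ is this with $x=\mu$ (it equals the conditional intensity $\lambda^*_m(y_1,\dots,y_m,\mu)=p(\mu\cup\{y_1,\dots,y_m\})/p(\mu)$). *)

(* Defs.v *)
From HB Require Import structures.
From mathcomp Require Import all_boot all_order all_algebra.
From mathcomp Require Import all_classical all_reals all_analysis.
Set Implicit Arguments. Unset Strict Implicit. Unset Printing Implicit Defensive.
Import Order.TTheory GRing.Theory Num.Theory.
Local Open Scope classical_set_scope.
Local Open Scope ring_scope.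

Section Geometry.
Context {R : realType}.

Definition pt := (R * R * R)%type.
Definition ptsub (p q : pt) : pt := ((p.1.1 - q.1.1, p.1.2 - q.1.2), p.2 - q.2).
Definition dot (p q : pt) : R := p.1.1 * q.1.1 + p.1.2 * q.1.2 + p.2 * q.2.
Definition enorm (p : pt) : R := Num.sqrt (dot p p).

Definition plate := (pt * R * pt)%type.
Definition pcentre (y : plate) : pt := y.1.1.
Definition pradius (y : plate) : R := y.1.2.
Definition pnormal (y : plate) : pt := y.2.

Definition disc (y : plate) : set pt :=
  [set p | enorm (ptsub p (pcentre y)) <= pradius y /\
           dot (ptsub p (pcentre y)) (pnormal y) = 0].

Definition area (y : plate) : R := pi * (pradius y) ^+ 2.

(* l(s \cap t): length of the intersection of two plates, i.e. the diameter
   of the (segment) s \cap t; 0 if the intersection is empty. *)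
Definition isect_len (s t : plate) : R :=
  sup [set d | exists a b, (disc s `&` disc t) a /\ (disc s `&` disc t) b /\
                          d = enorm (ptsub a b)].

Definition tri (s t u : plate) : R :=
  (asbool (disc s `&` disc t `&` disc u !=set0))%:R.

Definition dflt_plate : plate := ((0, 0, 0), 0, (0, 0, 0)).
Definition nthp (x : seq plate) (i : nat) : plate := nth dflt_plate x i.

Definition Stot (x : seq plate) : R := \sum_(i < size x) area (nthp x i).
Definition Ltot (x : seq plate) : R :=
  2^-1 * \sum_(i < size x) \sum_(j < size x | i != j)
          isect_len (nthp x i) (nthp x j).
Definition Ntot (x : seq plate) : R :=
  6^-1 * \sum_(i < size x) \sum_(j < size x) \sum_(k < size x |
            [&& i != j, i != k & j != k])
          tri (nthp x i) (nthp x j) (nthp x k).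

Definition nuG (nu1 nu2 nu3 : R) (x : seq plate) : R :=
  nu1 * Stot x + nu2 * Ltot x + nu3 * Ntot x.

(* First, second, third discrete derivatives of G (y, y_i not in x). *)
Definition D1 (nu1 nu2 nu3 : R) (x : seq plate) (y : plate) : R :=
  nu1 * area y
  + nu2 * (\sum_(i < size x) isect_len (nthp x i) y)
  + nu3 * (\sum_(i < size x) \sum_(j < size x | (i < j)%N)
             tri (nthp x i) (nthp x j) y).
Definition D2 (nu1 nu2 nu3 : R) (x : seq plate) (y1 y2 : plate) : R :=
  nu2 * isect_len y1 y2 + nu3 * (\sum_(i < size x) tri (nthp x i) y1 y2).
Definition D3 (nu1 nu2 nu3 : R) (y1 y2 y3 : plate) : R := nu3 * tri y1 y2 y3.

Definition nuQ (nu1 nu2 nu3 : R) (x ys : seq plate) : R :=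
  \sum_(i < size ys) D1 nu1 nu2 nu3 x (nthp ys i)
  + \sum_(i < size ys) \sum_(j < size ys | (i < j)%N)
       D2 nu1 nu2 nu3 x (nthp ys i) (nthp ys j)
  + \sum_(i < size ys) \sum_(j < size ys) \sum_(k < size ys | ((i < j) && (j < k))%N)
       D3 nu1 nu2 nu3 (nthp ys i) (nthp ys j) (nthp ys k).
Definition calE (nu1 nu2 nu3 : R) (x ys : seq plate) : R :=
  expR (nuQ nu1 nu2 nu3 x ys).

End Geometry.

Local Open Scope ereal_scope.

Section Measures.
Context {R : realType}.

Definition leb3 := ((@lebesgue_measure R) \x (@lebesgue_measure R)) \x (@lebesgue_measure R).

Definition hemisphere : set (@pt R) :=
  [set p | enorm p = 1%R /\ (0 <= p.2)%R].

(* integral over Y = B x (0,b] x S^2 w.r.t.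
   lambda(d(z,r,phi)) = rho(z) dz Q(dr) V(dphi) *)
Definition intY (B : set (@pt R)) (rho : @pt R -> R) (b : R)
  (Q : probability R R) (V : probability (@pt R) R)
  (f : @plate R -> \bar R) : \bar R :=
  \int[leb3]_(z in B) ((rho z)%:E *
     \int[Q]_(r in `]0%R, b]) \int[V]_(phi in hemisphere) f (z, r, phi)).

Fixpoint intYn B rho b Q V (n : nat) (F : seq (@plate R) -> \bar R) : \bar R :=
  match n with
  | 0 => F [::]
  | n'.+1 => intY B rho b Q V (fun y => intYn B rho b Q V n' (fun ys => F (y :: ys)))
  end.

Definition lamY B rho b Q V : \bar R := intY B rho b Q V (fun _ => 1).

(* Expectation of a nonnegative functional of the Poisson process eta with
   (finite) intensity measure lambda:
   E F(eta) = e^{-lambda(Y)} sum_n 1/n! int_{Y^n} F({y_1..y_n}) lambda^n(dy). *)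
Definition Epois B rho b Q V (F : seq (@plate R) -> \bar R) : \bar R :=
  (expR (- fine (lamY B rho b Q V)))%:E *
  \sum_(0 <= n <oo) ((n`!%:R)^-1)%:E * intYn B rho b Q V n F.

Definition cnu B rho b Q V (nu1 nu2 nu3 : R) : \bar R :=
  Epois B rho b Q V (fun x => (expR (nuG nu1 nu2 nu3 x))%:E).

Definition gibbs_density B rho b Q V (nu1 nu2 nu3 : R) (x : seq (@plate R)) : R :=
  ((fine (cnu B rho b Q V nu1 nu2 nu3))^-1 * expR (nuG nu1 nu2 nu3 x))%R.

Definition Egibbs B rho b Q V (nu1 nu2 nu3 : R) (F : seq (@plate R) -> \bar R) : \bar R :=
  Epois B rho b Q V (fun x => F x * (gibbs_density B rho b Q V nu1 nu2 nu3 x)%:E).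

End Measures.

(* Main.v *)
Require Import Defs.
From HB Require Import structures.
From mathcomp Require Import all_boot all_order all_algebra.
From mathcomp Require Import all_classical all_reals all_analysis.
From mathcomp Require Import measurable_realfun.
From mathcomp Require Import ring lra.
Import Order.TTheory GRing.Theory Num.Theory.
Local Open Scope classical_set_scope.
Local Open Scope ring_scope.
Local Open Scope ereal_scope.

Set Implicit Arguments. Unset Strict Implicit. Unset Printing Implicit Defensive.

(** The Gibbs expectation is a Poisson expectation weighted by
    [exp(nu . G)]. The Mecke formula turns the Poisson expectation of a sum over
    ordered selections of [m] distinct points into an [m]-fold integral; the
    discrete Taylor expansion of the cubic functional [G] gives
    [E_x(ys) * exp(nu . G x) = exp(nu . G(ys ++ x))], which identifies the
    integrand. The squares of [S], [L], [N] become sums over selections by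
    sorting pairs of pairs (of triples) of points by their number of common
    elements. Everything is nonnegative, so no integrability is needed; the
    measurability of [l(s cap t)] and of [1_(s cap t cap u <> empty)] follows
    from the compactness of the plates. *)

(** A configuration is a list and distinct points are distinct positions in it. [picks] peels a list
    as iterated integration peels its variables, so the Mecke formula becomes an induction: the [n]
    choices of a point turn [1/n!] into [1/(n-1)!]. The summand need not be symmetric, since drawn
    points come first and in order; only the Gibbs weight must be, being evaluated on the
    configuration before and after the draw rearranges it. Exchanging integrals needs a sigma-finite
    measure and jointly measurable partial integrals. The intensity is therefore a weight on a
    product measure over the whole space, and measurability carries a parameter space that absorbs
    the points already fixed. The coefficients count overlaps. Two ordered pairs can have exactly 0,
    1, 2 entries identified in 1, 4, 2 ways, and [L^2] gives each the weight [1/4]; two ordered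
    triples can have exactly 0, 1, 2, 3 entries identified in 1, 9, 18, 6 ways, each of weight
    [1/36] in [N^2]. *)

Section Selections.
Context {T : Type}.

Fixpoint picks (x : seq T) : seq (T * seq T) :=
  if x is a :: s then (a, s) :: [seq (p.1, a :: p.2) | p <- picks s] else [::].

(* Sum of [f (y_1 :: ... :: y_m :: r)] over all ways of drawing distinct entries
   [y_1, ..., y_m] of [x] in this order, leaving the entries [r]. *)
Fixpoint selsum {V : nmodType} (m : nat) (f : seq T -> V) (x : seq T) : V :=
  if m is k.+1 then (\sum_(p <- picks x) selsum k (fun s => f (p.1 :: s)) p.2)%R
  else f x.

Lemma picks_cons (V : nmodType) (f : T -> seq T -> V) a s :
  (\sum_(p <- picks (a :: s)) f p.1 p.2 =
   f a s + \sum_(p <- picks s) f p.1 (a :: p.2))%R.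
Proof. by rewrite /= big_cons big_map. Qed.

End Selections.

(** * Sums over unordered pairs and triples, their squares, and ordered selections *)

Section SymmetricSums.
Context {T : eqType} {R : realFieldType}.
Local Open Scope ring_scope.
Implicit Types (x s r : seq T) (f : T -> R) (h : T -> T -> R) (t : T -> T -> T -> R).

(** Each pair of positions is met once, the earlier entry first. For the symmetric kernels of the
    plates this absorbs the factor [1/2] of [L], and [tsum] likewise the [1/6] of [N]. *)
Fixpoint psum h x : R :=
  if x is a :: s then \sum_(z <- s) h a z + psum h s else 0.

Fixpoint tsum t x : R :=
  if x is a :: s then psum (t a) s + tsum t s else 0.

Lemma psum_cat h x s :
  psum h (x ++ s) = psum h x + \sum_(y <- x) \sum_(z <- s) h y z + psum h s.
Proof.
elim: x => [|a x IH] /=; first by rewrite big_nil; ring.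
by rewrite IH big_cons big_cat /=; ring.
Qed.

Lemma psumZ c h x : psum (fun y z => c * h y z) x = c * psum h x.
Proof. by elim: x => [|a x IH] /=; rewrite ?mulr0// IH mulrDr mulr_sumr. Qed.

Lemma eq_psum h h' x : h =2 h' -> psum h x = psum h' x.
Proof.
by move=> hh; elim: x => //= a x ->; congr (_ + _); apply: eq_bigr => z _.
Qed.

Lemma picks_perm x p : p \in picks x -> perm_eq (p.1 :: p.2) x.
Proof.
elim: x p => //= a x IH p; rewrite inE => /predU1P[->//|/mapP[q qx ->]] /=.
apply: (@perm_trans _ (a :: q.1 :: q.2)); last by rewrite perm_cons; exact: IH.
by apply/permPl; exact: (perm_catCA [:: q.1] [:: a] q.2).
Qed.

Lemma mem_picks x a : a \in x -> (a, rem a x) \in picks x.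
Proof.
elim: x => //= b x IH; rewrite inE eq_sym; case: eqVneq => [->|ba] /= ax.
  by rewrite mem_head.
rewrite inE; apply/orP; right.
by apply/mapP; exists (a, rem a x); first exact: IH.
Qed.

Lemma picks_sum f x p : p \in picks x ->
  \sum_(z <- x) f z = f p.1 + \sum_(z <- p.2) f z.
Proof. by move=> /picks_perm px; rewrite -(perm_big _ px) big_cons. Qed.

(** Symmetry of [h] lets any drawn entry play the part of the head. Together with [picks_tsum], this
    is how a total is later split according to the points it shares with a selection. *)
Lemma picks_psum h x p : (forall y z, h y z = h z y) -> p \in picks x ->
  psum h x = \sum_(z <- p.2) h p.1 z + psum h p.2.
Proof.
move=> hC; elim: x p => //= a x IH p; rewrite inE => /predU1P[->//|/mapP[q qx ->]] /=.
by rewrite (IH _ qx) (picks_sum _ qx) big_cons (hC a q.1); ring.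
Qed.

Lemma picks_tsum t x p : (forall y z u, t y z u = t z y u) ->
  (forall y z u, t y z u = t y u z) -> p \in picks x ->
  tsum t x = psum (t p.1) p.2 + tsum t p.2.
Proof.
move=> tC1 tC2; elim: x p => //= a x IH p.
rewrite inE => /predU1P[->//|/mapP[q qx ->]] /=.
rewrite (IH _ qx) (picks_psum (tC2 a) qx).
have -> : \sum_(z <- q.2) t a q.1 z = \sum_(z <- q.2) t q.1 a z.
  by apply: eq_bigr => z _; exact: tC1.
by ring.
Qed.

Lemma perm_psum h x s : (forall y z, h y z = h z y) -> perm_eq x s ->
  psum h x = psum h s.
Proof.
move=> hC; elim: x s => [|a x IH] s; first by rewrite perm_sym => /perm_nilP ->.
move=> xs; have as_ : a \in s by rewrite -(perm_mem xs) mem_head.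
rewrite (picks_psum hC (mem_picks as_)) /=.
have xr : perm_eq x (rem a s).
  by rewrite -(perm_cons a) (perm_trans xs)// perm_to_rem.
by rewrite (perm_big _ xr) (IH _ xr).
Qed.

Lemma perm_tsum t x s : (forall y z u, t y z u = t z y u) ->
  (forall y z u, t y z u = t y u z) -> perm_eq x s -> tsum t x = tsum t s.
Proof.
move=> tC1 tC2; elim: x s => [|a x IH] s; first by rewrite perm_sym => /perm_nilP ->.
move=> xs; have as_ : a \in s by rewrite -(perm_mem xs) mem_head.
rewrite (picks_tsum tC1 tC2 (mem_picks as_)) /=.
have xr : perm_eq x (rem a s).
  by rewrite -(perm_cons a) (perm_trans xs)// perm_to_rem.
by rewrite (perm_psum (tC2 a) xr) (IH _ xr).
Qed.

Lemma sum_picks1 f x : \sum_(p <- picks x) f p.1 = \sum_(z <- x) f z.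
Proof.
elim: x => [|a x IH]; first by rewrite !big_nil.
by rewrite (@picks_cons _ _ (fun y _ => f y)) IH big_cons.
Qed.

Lemma sum_picks2 h x : (forall y z, h y z = h z y) ->
  \sum_(p <- picks x) \sum_(z <- p.2) h p.1 z = 2 * psum h x.
Proof.
move=> hC; elim: x => [|a x IH]; first by rewrite !big_nil mulr0.
rewrite (@picks_cons _ _ (fun y r => \sum_(z <- r) h y z)).
under [X in _ + X = _]eq_bigr do rewrite big_cons hC.
by rewrite big_split /= (sum_picks1 (h a)) IH; ring.
Qed.

Lemma sum_picks3 t x : (forall y z u, t y z u = t z y u) ->
  (forall y z u, t y z u = t y u z) ->
  \sum_(p <- picks x) psum (t p.1) p.2 = 3 * tsum t x.
Proof.
move=> tC1 tC2; elim: x => [|a x IH]; first by rewrite !big_nil mulr0.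
rewrite (@picks_cons _ _ (fun y r => psum (t y) r)) /=.
rewrite big_split /= IH.
under eq_bigr => p _ do under eq_bigr do rewrite tC1.
by rewrite (sum_picks2 _ (tC2 a)); ring.
Qed.

(** Two draws leave the same remainder in either order. When the head is peeled off, the terms that
    draw it first and those that draw it second trade places, so [F] itself may be asymmetric. *)
Lemma picksC (F : T -> T -> seq T -> R) x :
  \sum_(p <- picks x) \sum_(q <- picks p.2) F p.1 q.1 q.2 =
  \sum_(p <- picks x) \sum_(q <- picks p.2) F q.1 p.1 q.2.
Proof.
elim: x F => [|a x IH] F; first by rewrite !big_nil.
rewrite (@picks_cons _ _ (fun y r => \sum_(q <- picks r) F y q.1 q.2)).
rewrite (@picks_cons _ _ (fun y r => \sum_(q <- picks r) F q.1 y q.2)).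
under [X in _ + X = _]eq_bigr do rewrite (@picks_cons _ _ (F _)).
under [X in _ = _ + X]eq_bigr do rewrite (@picks_cons _ _ (fun z r => F z _ r)).
rewrite !big_split /= (IH (fun y z r => F y z (a :: r))).
by rewrite !addrA [X in X + _]addrC.
Qed.

Let sum3 (F : T -> T -> T -> seq T -> R) x : R :=
  \sum_(p <- picks x) \sum_(q <- picks p.2) \sum_(r <- picks q.2) F p.1 q.1 r.1 r.2.

(** The two adjacent transpositions generate every permutation of three draws. *)
Let sum3C1 F x : sum3 F x = sum3 (fun y z u r => F z y u r) x.
Proof. exact: (picksC (fun y z s => \sum_(r <- picks s) F y z r.1 r.2)). Qed.

Let sum3C2 F x : sum3 F x = sum3 (fun y z u r => F y u z r) x.
Proof. by apply: eq_bigr => p _; exact: (picksC (F p.1)). Qed.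

Let sum3D F G x : sum3 (fun y z u r => F y z u r + G y z u r) x = sum3 F x + sum3 G x.
Proof.
rewrite -big_split /=; apply: eq_bigr => p _; rewrite -big_split /=.
by apply: eq_bigr => q _; rewrite -big_split.
Qed.

Let sum3Z c F x : sum3 (fun y z u r => c * F y z u r) x = c * sum3 F x.
Proof.
rewrite mulr_sumr; apply: eq_bigr => p _; rewrite mulr_sumr.
by apply: eq_bigr => q _; rewrite mulr_sumr.
Qed.

Context (d : T).

Lemma sum_selsum f x : \sum_(z <- x) f z = selsum 1 (fun s => f (nth d s 0)) x.
Proof. by rewrite -sum_picks1. Qed.

Lemma sqr_sum_selsum f x : (\sum_(z <- x) f z) ^+ 2 =
  selsum 2 (fun s => f (nth d s 0) * f (nth d s 1)) x +
  selsum 1 (fun s => f (nth d s 0) ^+ 2) x.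
Proof.
rewrite expr2 -{1}sum_picks1 mulr_suml -big_split /=.
apply: eq_big_seq => p px; rewrite (picks_sum f px) -mulr_sumr.
by rewrite (sum_picks1 f); ring.
Qed.

Section Pairs.
Context (h : T -> T -> R) (hC : forall y z, h y z = h z y).
Let h_ (s : seq T) i j := h (nth d s i) (nth d s j).

Lemma psum_selsum x : psum h x = 2^-1 * selsum 2 (fun s => h_ s 0 1) x.
Proof.
rewrite /h_ /=; under eq_bigr do rewrite (sum_picks1 (h _)).
by rewrite sum_picks2//; field.
Qed.

(** One factor becomes half a sum over ordered draws [(y, z)]; the other splits into pairs avoiding
    [y] and [z], pairs containing exactly one of them, and the pair [{y, z}] itself. *)
Lemma sqr_psum_selsum x : psum h x ^+ 2 =
  4^-1 * selsum 4 (fun s => h_ s 0 1 * h_ s 2 3) x +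
  selsum 3 (fun s => h_ s 0 1 * h_ s 2 0) x +
  2^-1 * selsum 2 (fun s => h_ s 0 1 ^+ 2) x.
Proof.
rewrite /h_ /=.
pose S2 (F : T -> T -> seq T -> R) :=
  \sum_(p <- picks x) \sum_(q <- picks p.2) F p.1 q.1 q.2.
have -> : psum h x ^+ 2 = 2^-1 * S2 (fun y z r => h y z * psum h x).
  rewrite expr2 {1}psum_selsum /h_ /= -mulrA mulr_suml; congr (_ * _).
  by apply: eq_bigr => p _; rewrite mulr_suml.
(* The factor [h z y] in the third term makes [picksC] turn that term literally into the second, so
   pairs with one common point get the coefficient [2 * 2^-1 = 1]. *)
have -> : S2 (fun y z r => h y z * psum h x) = S2 (fun y z r =>
   (h y z * psum h r + h y z * \sum_(u <- r) h u y) +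
   (h z y * \sum_(u <- r) h u z + h y z ^+ 2)).
  apply: eq_big_seq => p px; apply: eq_big_seq => q qp.
  rewrite (picks_psum hC px) (picks_psum hC qp) (picks_sum _ qp) (hC q.1 p.1).
  have E y : \sum_(u <- q.2) h u y = \sum_(u <- q.2) h y u.
    by apply: eq_bigr => u _; exact: hC.
  by rewrite !E; ring.
have S2D F G : S2 (fun y z r => F y z r + G y z r) = S2 F + S2 G.
  rewrite -big_split /=; apply: eq_bigr => p _; exact: big_split.
rewrite !S2D [S2 (fun y z r => h z y * _)](picksC (fun y z r => h z y * \sum_(u <- r) h u z)).
rewrite -/(S2 (fun y z r => h y z * \sum_(u <- r) h u y)).
have -> : \sum_(p <- picks x) \sum_(p0 <- picks p.2) \sum_(p1 <- picks p0.2)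
    \sum_(p2 <- picks p1.2) h p.1 p0.1 * h p1.1 p2.1 =
    2 * S2 (fun y z r => h y z * psum h r).
  rewrite mulr_sumr; apply: eq_bigr => p _; rewrite mulr_sumr; apply: eq_bigr => q _.
  under eq_bigr do rewrite -mulr_sumr (sum_picks1 (h _)).
  by rewrite -mulr_sumr sum_picks2//; ring.
have -> : \sum_(p <- picks x) \sum_(p0 <- picks p.2) \sum_(p1 <- picks p0.2)
    h p.1 p0.1 * h p1.1 p.1 = S2 (fun y z r => h y z * \sum_(u <- r) h u y).
  apply: eq_bigr => p _; apply: eq_bigr => q _.
  by rewrite -mulr_sumr (sum_picks1 (fun u => h u p.1)).
by rewrite -/(S2 (fun y z r => h y z ^+ 2)); field.
Qed.

End Pairs.

Section Triples.
Context (t : T -> T -> T -> R) (tC1 : forall y z u, t y z u = t z y u)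
  (tC2 : forall y z u, t y z u = t y u z).
Let t_ (s : seq T) i j k := t (nth d s i) (nth d s j) (nth d s k).

Lemma tsum_selsum x : tsum t x = 6^-1 * selsum 3 (fun s => t_ s 0 1 2) x.
Proof.
rewrite /t_ /=.
under eq_bigr => p _.
  under eq_bigr do rewrite (sum_picks1 (t _ _)).
  rewrite (sum_picks2 _ (tC2 p.1)); over.
by rewrite -mulr_sumr sum_picks3//; field.
Qed.

(** One factor becomes a sixth of a sum over ordered draws [(y, z, u)]; the other is split by the
    drawn points it contains. The idempotence of [t] serves the diagonal part, where both triples
    coincide. *)
Lemma sqr_tsum_selsum x : (forall y z u, t y z u ^+ 2 = t y z u) ->
  tsum t x ^+ 2 =
  36^-1 * selsum 6 (fun s => t_ s 0 1 2 * t_ s 3 4 5) x +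
  4^-1 * selsum 5 (fun s => t_ s 0 1 2 * t_ s 3 4 0) x +
  2^-1 * selsum 4 (fun s => t_ s 0 1 2 * t_ s 3 1 0) x +
  6^-1 * selsum 3 (fun s => t_ s 0 1 2) x.
Proof.
move=> tt; rewrite /t_ /=.
have tC3 y z u : t y z u = t u z y by rewrite tC1 tC2 tC1.
have -> : tsum t x ^+ 2 = 6^-1 * sum3 (fun y z u r => t y z u * tsum t x) x.
  rewrite expr2 {1}tsum_selsum /t_ /= -mulrA mulr_suml; congr (_ * _).
  apply: eq_bigr => p _; rewrite mulr_suml; apply: eq_bigr => q _.
  by rewrite mulr_suml.
(* [A] collects the triples sharing exactly [y] and [z] with the draw, [B] those sharing only [y].
   Each occurs in three versions, all equal after permuting the draws: hence [3/6] for [A], and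
   [3/6] times [1/2] for [B], whose remaining pair is unordered. *)
pose A y z u r := t y z u * \sum_(v <- r) t v z y.
pose B y z u r := t y z u * psum (t y) r.
have -> : sum3 (fun y z u r => t y z u * tsum t x) x =
  sum3 (fun y z u r => t y z u + t y z u * tsum t r + (A y z u r + A y u z r + A z u y r)
    + (B y z u r + B z y u r + B u z y r)) x.
  apply: eq_big_seq => p px; apply: eq_big_seq => q qp; apply: eq_big_seq => r rq.
  rewrite (picks_tsum tC1 tC2 px) (picks_tsum tC1 tC2 qp) (picks_tsum tC1 tC2 rq).
  rewrite (picks_psum (tC2 p.1) qp) (picks_psum (tC2 p.1) rq) (picks_psum (tC2 q.1) rq).
  rewrite (picks_sum _ rq) /A /B.
  have [e1 e2] : t p.1 r.1 q.1 = t p.1 q.1 r.1 /\ t q.1 p.1 r.1 = t p.1 q.1 r.1 by [].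
  have [e3 e4] : t q.1 r.1 p.1 = t p.1 q.1 r.1 /\ t r.1 q.1 p.1 = t p.1 q.1 r.1.
    by rewrite tC2 tC1 tC3.
  rewrite e1 e2 e3 e4.
  have E y z : \sum_(v <- r.2) t v z y = \sum_(v <- r.2) t y z v.
    by apply: eq_bigr => v _; rewrite tC3.
  rewrite !E; have := tt p.1 q.1 r.1; rewrite expr2 => e.
  by ring: e.
rewrite !sum3D -/(sum3 A x) -/(sum3 B x).
have -> : sum3 (fun y z u r => A y u z r) x = sum3 A x by rewrite sum3C2.
have -> : sum3 (fun y z u r => A z u y r) x = sum3 A x by rewrite sum3C1 sum3C2.
have -> : sum3 (fun y z u r => B z y u r) x = sum3 B x by rewrite sum3C1.
have -> : sum3 (fun y z u r => B u z y r) x = sum3 B x.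
  by rewrite sum3C1 sum3C2 sum3C1.
have -> : \sum_(p <- picks x) \sum_(p0 <- picks p.2) \sum_(p1 <- picks p0.2)
    \sum_(p2 <- picks p1.2) \sum_(p3 <- picks p2.2) \sum_(p4 <- picks p3.2)
    t p.1 p0.1 p1.1 * t p2.1 p3.1 p4.1 =
    6 * sum3 (fun y z u r => t y z u * tsum t r) x.
  rewrite -sum3Z; apply: eq_bigr => p _; apply: eq_bigr => q _; apply: eq_bigr => r _.
  transitivity (t p.1 q.1 r.1 * selsum 3 (fun s => t_ s 0 1 2) r.2).
    rewrite /t_ /= mulr_sumr; apply: eq_bigr => u _; rewrite mulr_sumr.
    by apply: eq_bigr => v _; rewrite mulr_sumr.
  by rewrite tsum_selsum; field.
have -> : \sum_(p <- picks x) \sum_(p0 <- picks p.2) \sum_(p1 <- picks p0.2)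
    \sum_(p2 <- picks p1.2) \sum_(p3 <- picks p2.2)
    t p.1 p0.1 p1.1 * t p2.1 p3.1 p.1 = 2 * sum3 B x.
  rewrite -sum3Z; apply: eq_bigr => p _; apply: eq_bigr => q _; apply: eq_bigr => r _.
  rewrite /B mulrCA -(sum_picks2 _ (tC2 p.1)) mulr_sumr.
  apply: eq_bigr => u _; rewrite -mulr_sumr (sum_picks1 (fun v => t u.1 v p.1)).
  by congr (_ * _); apply: eq_bigr => v _; rewrite tC3 tC2.
have -> : \sum_(p <- picks x) \sum_(p0 <- picks p.2) \sum_(p1 <- picks p0.2)
    \sum_(p2 <- picks p1.2) t p.1 p0.1 p1.1 * t p2.1 p0.1 p.1 = sum3 A x.
  apply: eq_bigr => p _; apply: eq_bigr => q _; apply: eq_bigr => r _.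
  by rewrite -mulr_sumr (sum_picks1 (fun v => t v q.1 p.1)).
by rewrite -/(sum3 (fun y z u r => t y z u) x); field.
Qed.

End Triples.
End SymmetricSums.

(** * From sums over indices to the recursive pair and triple sums *)

Section IndexedSums.
Context {T : eqType} {R : realFieldType} (d : T).
Local Open Scope ring_scope.
Implicit Types (x : seq T) (f : T -> R) (h : T -> T -> R) (t : T -> T -> T -> R).

Let sum_ord_recl n (P : pred nat) (F : nat -> R) :
  \sum_(i < n.+1 | P i) F i =
  (if P 0%N then F 0%N else 0) + \sum_(i < n | P i.+1) F i.+1.
Proof. by rewrite big_mkcond big_ord_recl -big_mkcond. Qed.

Let sum_ord_recl0 n (P : pred nat) (F : nat -> R) : P 0%N = false ->
  \sum_(i < n.+1 | P i) F i = \sum_(i < n | P i.+1) F i.+1.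
Proof. by move=> P0; rewrite sum_ord_recl P0 add0r. Qed.

Lemma sum_nth f x : \sum_(i < size x) f (nth d x i) = \sum_(z <- x) f z.
Proof. by rewrite (big_nth d) big_mkord. Qed.

Lemma sum_nth_ltn h x :
  \sum_(i < size x) \sum_(j < size x | (i < j)%N) h (nth d x i) (nth d x j) =
  psum h x.
Proof.
elim: x => [|a x IH] /=; first by rewrite big_ord0.
rewrite big_ord_recl -(sum_nth (h a)) -IH; congr (_ + _).
  exact: (@sum_ord_recl0 _ (fun j => 0 < j)%N (fun j => h a (nth d (a :: x) j))).
apply: eq_bigr => i _.
exact: (@sum_ord_recl0 _ (fun j => i.+1 < j)%N (fun j => h _ (nth d (a :: x) j))).
Qed.

Lemma sum_nth_ltn3 t x :
  \sum_(i < size x) \sum_(j < size x) \sum_(k < size x | (i < j)%N && (j < k)%N)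
    t (nth d x i) (nth d x j) (nth d x k) = tsum t x.
Proof.
elim: x => [|a x IH] /=; first by rewrite big_ord0.
rewrite big_ord_recl big_ord_recl big_pred0_eq add0r; congr (_ + _).
  rewrite -(sum_nth_ltn (t a)); apply: eq_bigr => j _.
  exact: (@sum_ord_recl0 _ (fun k => (0 < j.+1) && (j.+1 < k))%N
    (fun k => t _ _ (nth d (a :: x) k))).
rewrite -IH; apply: eq_bigr => i _; rewrite big_ord_recl big_pred0_eq add0r.
apply: eq_bigr => j _.
apply: (@sum_ord_recl0 _ (fun k => (i.+1 < j.+1) && (j.+1 < k))%N
    (fun k => t _ _ (nth d (a :: x) k))).
by rewrite andbF.
Qed.

Lemma sum_nth_neq h x : (forall y z, h y z = h z y) ->
  \sum_(i < size x) \sum_(j < size x | i != j) h (nth d x i) (nth d x j) =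
  2 * psum h x.
Proof.
(* The inequality of ordinals is restated on [nat], the form in which [sum_ord_recl] can split off
   index 0. *)
move=> hC; transitivity (\sum_(i < size x) \sum_(j < size x | (i : nat) != j)
   h (nth d x i) (nth d x j)); first by [].
elim: x => [|a x IH] /=; first by rewrite big_ord0 mulr0.
have E0 : \sum_(j < (size x).+1 | 0%N != j) h a (nth d (a :: x) j) =
    \sum_(z <- x) h a z.
  rewrite -(sum_nth (h a)).
  exact: (@sum_ord_recl0 _ (fun j => 0%N != j) (fun j => h a (nth d (a :: x) j))).
have E1 (i : 'I_(size x)) : \sum_(j < (size x).+1 | i.+1 != j)
    h (nth d x i) (nth d (a :: x) j) =
    h a (nth d x i) + \sum_(j < size x | (i : nat) != j) h (nth d x i) (nth d x j).
  rewrite (sum_ord_recl _ (fun j => i.+1 != j) (fun j => h _ (nth d (a :: x) j))) /=.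
  by congr (_ + _); exact: hC.
rewrite big_ord_recl E0; under [X in _ + X = _]eq_bigr => i _ do rewrite E1.
by rewrite big_split /= (sum_nth (h a)) IH; ring.
Qed.

Lemma sum_nth_neq3 t x : (forall y z u, t y z u = t z y u) ->
  (forall y z u, t y z u = t y u z) ->
  \sum_(i < size x) \sum_(j < size x) \sum_(k < size x | [&& i != j, i != k & j != k])
    t (nth d x i) (nth d x j) (nth d x k) = 6 * tsum t x.
Proof.
move=> tC1 tC2.
transitivity (\sum_(i < size x) \sum_(j < size x)
  \sum_(k < size x | [&& (i : nat) != j, (i : nat) != k & (j : nat) != k])
  t (nth d x i) (nth d x j) (nth d x k)); first by [].
have tC3 y z u : t y z u = t u z y by rewrite tC1 tC2 tC1.
elim: x => [|a x IH] /=; first by rewrite big_ord0 mulr0.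
have E0 : \sum_(j < (size x).+1) \sum_(k < (size x).+1 |
    [&& 0%N != j, 0%N != k & (j : nat) != k])
    t a (nth d (a :: x) j) (nth d (a :: x) k) = 2 * psum (t a) x.
  rewrite big_ord_recl big_pred0_eq add0r -(sum_nth_neq _ (tC2 a)).
  apply: eq_bigr => j _.
  exact: (@sum_ord_recl0 _ (fun k => [&& 0%N != j.+1, 0%N != k & j.+1 != k])
    (fun k => t _ _ (nth d (a :: x) k))).
have E1 (i : 'I_(size x)) : \sum_(j < (size x).+1) \sum_(k < (size x).+1 |
    [&& i.+1 != j, i.+1 != k & (j : nat) != k])
    t (nth d x i) (nth d (a :: x) j) (nth d (a :: x) k) =
  \sum_(k < size x | i != k) t a (nth d x i) (nth d x k) +
  (\sum_(j < size x | i != j) t a (nth d x i) (nth d x j) +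
   \sum_(j < size x) \sum_(k < size x | [&& (i : nat) != j, (i : nat) != k & (j : nat) != k])
    t (nth d x i) (nth d x j) (nth d x k)).
  rewrite big_ord_recl; congr (_ + _).
    rewrite (sum_ord_recl _ (fun k => [&& i.+1 != 0%N, i.+1 != k & 0%N != k])
      (fun k => t _ _ (nth d (a :: x) k))) /= add0r.
    apply: eq_big => [k|k _]; first by rewrite andbT eqSS.
    exact: tC1.
  rewrite [X in X + _]big_mkcond -big_split; apply: eq_bigr => j _.
  rewrite lift0 (sum_ord_recl _ (fun k => [&& i.+1 != j.+1, i.+1 != k & j.+1 != k])
    (fun k => t _ _ (nth d (a :: x) k))) /= andbT.
  by congr (_ + _); rewrite eqSS tC3 tC2.
rewrite big_ord_recl E0.
under [X in _ + X = _]eq_bigr => i _ do rewrite lift0 E1.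
rewrite !big_split /= IH.
rewrite (sum_nth_neq _ (tC2 a)); ring.
Qed.

End IndexedSums.

(** * Measurability of the intersection length and of the triple intersection indicator *)

Import numFieldNormedType.Exports.

(* Compactness turns the uncountable projection into a countable one: the
   infimum of [f t] over a countable dense set is attained. *)
Lemma measurable_exists_le0 d (T : measurableType d) (R : realType)
    (P : topologicalType) (C : countType) (g : C -> P) (f : T -> P -> R) :
  dense (range g) ->
  (forall p, measurable_fun setT (f ^~ p)) -> (forall t, continuous (f t)) ->
  (forall t, exists2 K, compact K & forall p, (f t p <= 1)%R -> K p) ->
  measurable [set t | exists p, (f t p <= 0)%R].
Proof.
move=> dg mf cf Kf.
rewrite (_ : [set _ | _] =
  \bigcap_n \bigcup_k [set t | (f t (g k) < n.+1%:R^-1)%R]); last first.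
  apply/seteqP; split => [t [p fp] n _|t ft].
    have [q [/= fq [k _ gk]]] : [set q | (f t q < n.+1%:R^-1)%R] `&` range g !=set0.
      apply: dg; last first.
        by have /continuousP/(_ _ (@open_lt _ (n.+1%:R^-1)%R)) := cf t.
      by exists p => /=; rewrite (le_lt_trans fp)// invr_gt0.
    by exists k => //=; rewrite gk.
  have [K cK fK] := Kf t.
  (* All levels [1/(n+1)] are at most 1, so the approximating points lie in the one compact set
     [K]. *)
  have gK n k : (f t (g k) < n.+1%:R^-1)%R -> K (g k).
    by move=> /ltW fn; apply: fK; rewrite (le_trans fn)// invf_le1// ler1n.
  have K0 : K !=set0 by have [k _ /gK] := ft 0%N I; exists (g k).
  have [c _ cmin] := compact_EVT_min K0 cK (continuous_subspaceT (cf t)).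
  exists c; rewrite leNgt; apply/negP => fc0.
  (* This index makes [1/(n+1)] smaller than the supposedly positive minimum, while [g k] is a point
     of [K] with a value below [1/(n+1)]. *)
  have [k _ fk] := ft (Num.truncn (f t c)^-1) I.
  have := cmin (g k) (mem_set (gK _ _ fk)).
  rewrite leNgt => /negP; apply; rewrite (lt_trans fk)//.
  by rewrite invf_plt ?posrE//; exact: truncnS_gt.
apply: bigcapT_measurable => n; apply: countable_bigcupT_measurable => [|k]; first exact: countableP.
rewrite (_ : [set t | _] = setT `&` (f ^~ (g k)) @^-1` `]-oo, (n.+1%:R^-1)%R[).
  by apply: mf => //; exact: measurable_itv.
by apply/seteqP; split => t /=; rewrite in_itv/=; tauto.
Qed.


Lemma dense_range_prod (P1 P2 : topologicalType) (C1 C2 : Type)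
    (g1 : C1 -> P1) (g2 : C2 -> P2) : dense (range g1) -> dense (range g2) ->
  dense (range (fun q => (g1 q.1, g2 q.2))).
Proof.
move=> d1 d2 O [x Ox] oO.
have [[A1 A2] /= [nA1 nA2] AO] : nbhs x O by exact: open_nbhs_nbhs.
have [? [/interior_subset A1g [k1 _ gk1]]] :
    (interior A1 `&` range g1) !=set0 by apply: d1; [exists x.1|exact: open_interior].
have [? [/interior_subset A2g [k2 _ gk2]]] :
    (interior A2 `&` range g2) !=set0 by apply: d2; [exists x.2|exact: open_interior].
exists (g1 k1, g2 k2); split; last by exists (k1, k2).
by apply: AO; split => /=; rewrite ?gk1 ?gk2.
Qed.

Section PlateMeasurability.
Context {R : realType}.
Notation pt := (@pt R).
Notation plate := (@plate R).
Local Open Scope ring_scope.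

(* [defect y p <= 0] iff [p] lies on the plate [y]; unlike [enorm], it is
   polynomial in [y] and [p]. *)
Definition defect (y : plate) (p : pt) : R :=
  Num.max (Num.max (- pradius y)
    (dot (ptsub p (pcentre y)) (ptsub p (pcentre y)) - pradius y * pradius y))
  `|dot (ptsub p (pcentre y)) (pnormal y)|.

Lemma dot_ge0 (p : pt) : 0 <= dot p p.
Proof. by rewrite /dot !addr_ge0// -expr2 sqr_ge0. Qed.

(** Squaring the distance inequality loses the sign of the radius, and a disc of negative radius is
    empty; the entry [- pradius y] of the maximum restores this. *)
Lemma disc_defect y p : disc y p <-> defect y p <= 0.
Proof.
rewrite /disc /defect /= !ge_max oppr_le0 normr_le0 subr_le0 -expr2 /enorm.
have d0 := dot_ge0 (ptsub p (pcentre y)).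
split=> [[dr /eqP ->]|/andP[/andP[r0 dr] /eqP ->]].
  have r0 : 0 <= pradius y by apply: le_trans dr; exact: sqrtr_ge0.
  by rewrite r0 -(sqr_sqrtr d0) ler_sqr ?nnegrE ?sqrtr_ge0// dr.
by split=> //; rewrite -ler_sqr ?nnegrE ?sqrtr_ge0// sqr_sqrtr.
Qed.

Lemma measurable_defect p : measurable_fun setT (defect ^~ p).
Proof.
have m1 : measurable_fun setT (fun y : plate => y.1.1.1.1).
  by do 3 apply: measurableT_comp => //.
have m2 : measurable_fun setT (fun y : plate => y.1.1.1.2).
  by do 3 apply: measurableT_comp => //.
have m3 : measurable_fun setT (fun y : plate => y.1.1.2).
  by do 2 apply: measurableT_comp => //.
have m4 : measurable_fun setT (fun y : plate => y.1.2).
  by do 1 apply: measurableT_comp => //.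
have m5 : measurable_fun setT (fun y : plate => y.2.1.1).
  by do 2 apply: measurableT_comp => //.
have m6 : measurable_fun setT (fun y : plate => y.2.1.2).
  by do 2 apply: measurableT_comp => //.
have m7 : measurable_fun setT (fun y : plate => y.2.2).
  by do 1 apply: measurableT_comp => //.
rewrite /defect /dot /ptsub /pcentre /pradius /pnormal /=.
have mB (a : R) (f : plate -> R) : measurable_fun setT f -> measurable_fun setT (fun y : plate => a - f y).
  by move=> mf; apply: measurable_funB => //; exact: measurable_cst.
apply: measurable_maxr.
  apply: measurable_maxr; first exact: measurable_funN.
  apply: measurable_funB; last exact: measurable_funM.
  by apply: measurable_funD; first apply: measurable_funD;
    apply: measurable_funM; exact: mB.
apply: measurableT_comp => //.
by apply: measurable_funD; first apply: measurable_funD;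
  apply: measurable_funM => //; exact: mB.
Qed.

Let coord1 (p : pt) : {for p, continuous (fun p : pt => p.1.1)}.
Proof. by apply: (cvg_comp _ _ (@cvg_fst _ _ _ _ _)); exact: cvg_fst. Qed.

Let coord2 (p : pt) : {for p, continuous (fun p : pt => p.1.2)}.
Proof. by apply: (cvg_comp _ _ (@cvg_fst _ _ _ _ _)); exact: cvg_snd. Qed.

Let coord3 (p : pt) : {for p, continuous (fun p : pt => p.2)}.
Proof. exact: cvg_snd. Qed.

Lemma continuous_defect y : continuous (defect y).
Proof.
move=> p; rewrite /defect /dot /ptsub /pcentre /pradius /pnormal /=.
have cB (a : R) (f : pt -> R) : {for p, continuous f} -> {for p, continuous (fun q : pt => f q - a)}.
  by move=> cf; apply: continuousB => //; exact: cst_continuous.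
have cD (f1 f2 f3 g1 g2 g3 : pt -> R) : {for p, continuous f1} -> {for p, continuous f2} ->
    {for p, continuous f3} -> {for p, continuous g1} -> {for p, continuous g2} ->
    {for p, continuous g3} ->
    {for p, continuous (fun q : pt => f1 q * g1 q + f2 q * g2 q + f3 q * g3 q : R)}.
  by move=> *; apply: continuousD; first apply: continuousD; exact: continuousM.
have cM (f g : pt -> R) : {for p, continuous f} -> {for p, continuous g} ->
    {for p, continuous (fun q => Num.max (f q) (g q))}.
  by move=> cf cg; exact: (@continuous_max _ _ f g).
apply/cM.
  apply/cM; first exact: cst_continuous.
  by apply/cB; apply/cD; apply/cB.
apply: (continuous_comp _ (@norm_continuous _ _ _)).
by apply/cD; [exact: cB|exact: cB|exact: cB|..]; exact: cst_continuous.
Qed.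

Lemma compact_defect y : exists2 K, compact K & forall p, defect y p <= 1 -> K p.
Proof.
(* A defect at most 1 gives squared distance at most [1 + r^2 = b - 1]; since [b >= 1], each
   coordinate then differs from that of the centre by at most [b]. *)
pose b := 2 + pradius y * pradius y.
have b1 : 1 <= b by rewrite /b -addrA lerDl addr_ge0// -expr2 sqr_ge0.
pose I a : set R := `[a - b, a + b]%classic.
exists (I (pcentre y).1.1 `*` I (pcentre y).1.2 `*` I (pcentre y).2).
  by apply: compact_setX; [apply: compact_setX|]; exact: segment_compact.
move=> p; rewrite /defect !ge_max => /andP[/andP[_ +] _].
rewrite lerBlDr /dot /ptsub /= => db.
have h (u a : R) : (u - a) * (u - a) <= b - 1 -> I a u.
  rewrite /I /= in_itv /= => h; apply/andP; split; nra.
have := sqr_ge0 (p.1.1 - (pcentre y).1.1); have := sqr_ge0 (p.1.2 - (pcentre y).1.2).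
have := sqr_ge0 (p.2 - (pcentre y).2); rewrite !expr2 => h1 h2 h3.
by split; [split|]; apply: h; rewrite /b; lra.
Qed.

Let ptQ (q : rat * rat * rat) : pt := (ratr q.1.1, ratr q.1.2, ratr q.2).

Let dense_ptQ : dense (range ptQ).
Proof.
have dR : dense (range (@ratr R)) by exact: dense_rat.
exact: (dense_range_prod (dense_range_prod dR dR) dR).
Qed.

Let max3_le (a b c e : R) :
  (Num.max (Num.max a b) c <= e) = [&& a <= e, b <= e & c <= e].
Proof. by rewrite !ge_max andbA. Qed.

Let max5_le (a b c d e x : R) :
  (Num.max (Num.max (Num.max a b) (Num.max c d)) e <= x) =
  [&& a <= x, b <= x, c <= x, d <= x & e <= x].
Proof. by rewrite !ge_max !andbA. Qed.

Lemma measurable_tri :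
  measurable_fun setT (fun p : plate * plate * plate => tri p.1.1 p.1.2 p.2).
Proof.
pose f (t : plate * plate * plate) p :=
  Num.max (Num.max (defect t.1.1 p) (defect t.1.2 p)) (defect t.2 p).
have mA : measurable [set t | exists p, f t p <= 0].
  apply: (measurable_exists_le0 dense_ptQ) => [p|t|t].
  - have mp := measurable_defect p.
    apply: measurable_maxr; first apply: measurable_maxr.
    + exact: (measurableT_comp mp (measurableT_comp measurable_fst measurable_fst)).
    + exact: (measurableT_comp mp (measurableT_comp measurable_snd measurable_fst)).
    + exact: (measurableT_comp mp measurable_snd).
  - have cM (g h : pt -> R) : continuous g -> continuous h ->
        continuous (fun q => Num.max (g q) (h q)).
      by move=> cf cg p; exact: (continuous_max (cf p) (cg p)).
    by apply/cM; [apply/cM|]; exact: continuous_defect.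
  - have [K cK hK] := compact_defect t.2.
    by exists K => // p; rewrite /f max3_le => /and3P[_ _]; exact: hK.
rewrite (_ : (fun _ => _) = \1_[set t | exists p, f t p <= 0]).
  exact: measurable_indic.
apply/funext => -[[s t] u]; rewrite indicE /tri /=; congr (nat_of_bool _)%:R.
apply/idP/idP => [/asboolP[p [[sp tp] up]]|].
  rewrite inE /=; exists p.
  by rewrite /f max3_le; apply/and3P; split; exact/disc_defect.
rewrite inE /= => -[p]; rewrite /f max3_le => /and3P[sp tp up]; apply/asboolP.
by exists p; split; [split|]; exact/disc_defect.
Qed.

Let chords (s t : plate) : set R := [set d | exists a b,
  (disc s `&` disc t) a /\ (disc s `&` disc t) b /\ d = enorm (ptsub a b)].

Lemma sqr_enorm (p : pt) : enorm p ^+ 2 = dot p p.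
Proof. by rewrite sqr_sqrtr// dot_ge0. Qed.

(* Parallelogram law: [|a - b|^2 <= 2|a - z|^2 + 2|b - z|^2]. *)
Let chords_ubound s t : has_ubound (chords s t).
Proof.
exists (2 * pradius s) => _ [a [b [[[az _] _] [[[bz _] _] ->]]]].
have r0 : 0 <= pradius s by apply: le_trans az; exact: sqrtr_ge0.
rewrite -ler_sqr ?nnegrE ?sqrtr_ge0 ?mulr_ge0// sqr_enorm.
have sqr_le p : enorm p <= pradius s -> dot p p <= pradius s ^+ 2.
  by move=> pr; rewrite -sqr_enorm ler_sqr ?nnegrE ?sqrtr_ge0.
have sqrB (u v z : R) : (u - v) * (u - v) <= 2 * ((u - z) * (u - z)) + 2 * ((v - z) * (v - z)).
  by have := sqr_ge0 ((u - z) + (v - z)); rewrite expr2; lra.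
have := sqr_le _ az; have := sqr_le _ bz; rewrite /dot /ptsub /=.
have := sqrB a.1.1 b.1.1 (pcentre s).1.1; have := sqrB a.1.2 b.1.2 (pcentre s).1.2.
have := sqrB a.2 b.2 (pcentre s).2; lra.
Qed.

Lemma isect_len_ge0 (s t : plate) : 0 <= isect_len s t.
Proof.
rewrite /isect_len -/(chords s t).
have [->|/set0P[_ [a [b [ha [hb _]]]]]] := eqVneq (chords s t) set0.
  by rewrite sup0.
apply: (@le_trans _ _ (enorm (ptsub a b))); first exact: sqrtr_ge0.
by apply: ub_le_sup => //; exists a, b.
Qed.

Lemma isect_lenC (s t : plate) : isect_len s t = isect_len t s.
Proof. by rewrite /isect_len setIC. Qed.

Lemma tri_ge0 (s t u : plate) : 0 <= tri s t u.
Proof. by rewrite /tri. Qed.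

Lemma triCl (s t u : plate) : tri s t u = tri t s u.
Proof. by rewrite /tri (setIC (disc s)). Qed.

Lemma triCr (s t u : plate) : tri s t u = tri s u t.
Proof. by rewrite /tri setIAC. Qed.

Lemma tri_sqr (s t u : plate) : tri s t u ^+ 2 = tri s t u.
Proof. by rewrite /tri; case: asboolP; rewrite ?expr1n ?expr0n. Qed.

(** The supremum exceeds [c] iff some chord does. This strict inequality is the countable union over
    [n] of the closed conditions that a chord has length at least [c + 1/(n+1)], and each of these
    is the solvability of [f n t p <= 0] in the pair [p] of endpoints. *)
Lemma measurable_isect_len :
  measurable_fun setT (fun p : plate * plate => isect_len p.1 p.2).
Proof.
apply: (measurability _ (RGenOInfty.measurableE R)) => //= _ [_ [c ->] <-].
(* Only for [c >= 0] can the bound be squared; it also excludes disjoint plates, whose [sup] over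
   the empty set is 0. *)
rewrite setTI; have [c0|c0] := ltP c 0.
  rewrite (_ : _ @^-1` _ = setT)//; apply/seteqP; split => // p _ /=.
  by rewrite in_itv /= andbT (lt_le_trans c0)// isect_len_ge0.
pose f n (t : plate * plate) (p : pt * pt) :=
  Num.max (Num.max (Num.max (defect t.1 p.1) (defect t.2 p.1))
    (Num.max (defect t.1 p.2) (defect t.2 p.2)))
  ((c + n.+1%:R^-1) ^+ 2 - dot (ptsub p.1 p.2) (ptsub p.1 p.2)).
rewrite (_ : _ @^-1` _ = \bigcup_n [set t | exists p, f n t p <= 0]); last first.
  apply/seteqP; split => -[s t] /=; rewrite in_itv/= andbT.
    rewrite /isect_len -/(chords s t) => cs.
    have ch0 : chords s t !=set0.
      by apply/set0P/eqP => ch0; move: cs; rewrite ch0 sup0 ltNge c0.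
    have [_ [a [b [[sa ta] [[sb tb] ->]]]] cd] := sup_gt ch0 cs.
    exists (Num.truncn (enorm (ptsub a b) - c)^-1) => //=; exists (a, b).
    set n := Num.truncn _.
    have nd : n.+1%:R^-1 <= enorm (ptsub a b) - c.
      by rewrite invf_ple ?posrE ?subr_gt0// ltW// truncnS_gt.
    rewrite /f max5_le; apply/and5P; split; try exact/disc_defect.
    rewrite subr_le0 -sqr_enorm ler_sqr ?nnegrE ?sqrtr_ge0 ?addr_ge0 ?invr_ge0//.
    by rewrite -lerBrDl.
  move=> [n _ [[a b]]]; rewrite /f max5_le /= => /and5P[sa ta sb tb].
  have cn0 : 0 < n.+1%:R^-1 :> R by rewrite invr_gt0.
  rewrite subr_le0 -sqr_enorm ler_sqr ?nnegrE ?sqrtr_ge0 ?addr_ge0 ?(ltW cn0)// => ab.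
  apply: (@lt_le_trans _ _ (enorm (ptsub a b))).
    by apply: lt_le_trans ab; rewrite ltrDl.
  apply: (ub_le_sup (chords_ubound s t)); exists a, b.
  by split; [split|split; [split|]] => //; exact/disc_defect.
apply: bigcupT_measurable => n.
apply: (measurable_exists_le0 (dense_range_prod dense_ptQ dense_ptQ)) => [p|t|t].
- have m1 := measurable_defect p.1; have m2 := measurable_defect p.2.
  apply: measurable_maxr; last exact: measurable_cst.
  apply: measurable_maxr; apply: measurable_maxr.
  + exact: (measurableT_comp m1 measurable_fst).
  + exact: (measurableT_comp m1 measurable_snd).
  + exact: (measurableT_comp m2 measurable_fst).
  + exact: (measurableT_comp m2 measurable_snd).
- have cM (g h : pt * pt -> R) : continuous g -> continuous h ->
      continuous (fun q => Num.max (g q) (h q)).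
    by move=> cf cg p; exact: (continuous_max (cf p) (cg p)).
  have c1 y : continuous (fun p : pt * pt => defect y p.1).
    move=> p; apply: (cvg_comp fst (defect y)); [exact: cvg_fst|exact: continuous_defect].
  have c2 y : continuous (fun p : pt * pt => defect y p.2).
    move=> p; apply: (cvg_comp snd (defect y)); [exact: cvg_snd|exact: continuous_defect].
  apply/cM; first by apply/cM; apply/cM; [exact: c1|exact: c1|exact: c2|exact: c2].
  move=> p; rewrite /dot /ptsub /=.
  have cB (g : pt -> R) : (forall x, {for x, continuous g}) ->
      {for p, continuous (fun q : pt * pt => g q.1 - g q.2)}.
    move=> cg; apply: continuousB; first exact: (cvg_comp fst g cvg_fst (cg _)).
    exact: (cvg_comp snd g cvg_snd (cg _)).
  apply: cvgB; first exact: cvg_cst.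
  have k1 := cB _ coord1; have k2 := cB _ coord2; have k3 := cB _ coord3.
  by apply: cvgD; first apply: cvgD; exact: cvgM.
- have [K cK hK] := compact_defect t.1.
  exists (K `*` K); first exact: compact_setX.
  move=> p; rewrite /f max5_le => /and5P[h1 _ h2 _ _].
  by split; exact: hK.
Qed.

End PlateMeasurability.

(** * The totals of a configuration and their discrete Taylor expansion *)

Section PlateFunctionals.
Context {R : realType} (nu1 nu2 nu3 : R).
Local Open Scope ring_scope.
Implicit Types x ys : seq (@plate R).

Lemma Stot_sum x : Stot x = \sum_(z <- x) area z.
Proof. exact: sum_nth. Qed.

Lemma Ltot_psum x : Ltot x = psum isect_len x.
Proof.
rewrite /Ltot (_ : \sum_(i < size x) _ = 2 * psum isect_len x) ?mulKf ?pnatr_eq0//.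
by apply: sum_nth_neq; exact: isect_lenC.
Qed.

Lemma Ntot_tsum x : Ntot x = tsum tri x.
Proof.
rewrite /Ntot (_ : \sum_(i < size x) _ = 6 * tsum tri x) ?mulKf ?pnatr_eq0//.
by apply: sum_nth_neq3; [exact: triCl|exact: triCr].
Qed.

Lemma nuG_perm x s : perm_eq x s -> nuG nu1 nu2 nu3 x = nuG nu1 nu2 nu3 s.
Proof.
move=> xs; rewrite /nuG !Stot_sum !Ltot_psum !Ntot_tsum (perm_big _ xs).
by rewrite (perm_psum (@isect_lenC R) xs) (perm_tsum (@triCl R) (@triCr R) xs).
Qed.

Lemma nuG_cons x y : nuG nu1 nu2 nu3 (y :: x) = nuG nu1 nu2 nu3 x + nu1 * area y +
  nu2 * (\sum_(z <- x) isect_len y z) + nu3 * psum (tri y) x.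
Proof.
rewrite /nuG !Stot_sum !Ltot_psum !Ntot_tsum big_cons /=; ring.
Qed.

Lemma nuQ_sum x ys : nuQ nu1 nu2 nu3 x ys =
  \sum_(y <- ys) D1 nu1 nu2 nu3 x y + psum (D2 nu1 nu2 nu3 x) ys +
  tsum (D3 nu1 nu2 nu3) ys.
Proof.
rewrite -(sum_nth dflt_plate) -(sum_nth_ltn dflt_plate).
by rewrite -(sum_nth_ltn3 dflt_plate).
Qed.

(* The discrete Taylor formula for [G], which is cubic in the configuration. *)
Lemma nuQ_nuG x ys :
  nuQ nu1 nu2 nu3 x ys + nuG nu1 nu2 nu3 x = nuG nu1 nu2 nu3 (ys ++ x).
Proof.
rewrite nuQ_sum; elim: ys => [|y ys IH] /=; first by rewrite big_nil !add0r.
rewrite nuG_cons -IH big_cons /= big_cat /= psum_cat /D1.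
(* The new triples through [y] are split by how many of their other two points lie in [x]: two
   belong to [D1], one to [D2], none to [D3]. For new pairs, a partner in [x] belongs to [D1], one
   in [ys] to [D2]. *)
rewrite (eq_psum ys (_ : D3 nu1 nu2 nu3 y =2 fun u v => nu3 * tri y u v))// psumZ.
rewrite (sum_nth dflt_plate (isect_len ^~ y)) (sum_nth_ltn dflt_plate (fun u v => tri u v y)).
rewrite (eq_psum x (_ : (fun u v => tri u v y) =2 tri y)); last first.
  by move=> u v; rewrite triCr triCl.
have -> : \sum_(z <- x) isect_len z y = \sum_(z <- x) isect_len y z.
  by apply: eq_bigr => z _; exact: isect_lenC.
have -> : \sum_(z <- ys) D2 nu1 nu2 nu3 x y z = nu2 * (\sum_(z <- ys) isect_len y z) +
    nu3 * (\sum_(z <- ys) \sum_(u <- x) tri y z u).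
  rewrite !mulr_sumr -big_split /=; apply: eq_bigr => z _; rewrite /D2.
  rewrite (sum_nth dflt_plate (fun u => tri u y z)); congr (_ + _ * _).
  by apply: eq_bigr => u _; rewrite triCl triCr.
by ring.
Qed.

Lemma calE_expR x ys : calE nu1 nu2 nu3 x ys * expR (nuG nu1 nu2 nu3 x) =
  expR (nuG nu1 nu2 nu3 (ys ++ x)).
Proof. by rewrite /calE -expRD nuQ_nuG. Qed.

End PlateFunctionals.

(** * Measurability of functions of finite sequences with a parameter *)

Section MeasurableSequences.
Context {d} {T : measurableType d} {R : realType}.

(** Measurability is asked length by length, on tuples. The parameter in [U] holds the points
    already taken off the list; joint measurability in it is what Tonelli asks for. *)
Definition smeasurable d' (U : measurableType d') (F : U -> seq T -> \bar R) :=
  forall n, measurable_fun setT (fun p : U * n.-tuple T => F p.1 p.2).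

Lemma smeasurable_cons d' (U : measurableType d') (F : U -> seq T -> \bar R) :
  smeasurable F -> smeasurable (fun (p : U * T) s => F p.1 (p.2 :: s)).
Proof.
move=> mF n.
pose h (q : U * T * n.-tuple T) : U * n.+1.-tuple T :=
  (q.1.1, [the n.+1.-tuple T of q.1.2 :: q.2]).
have mh : measurable_fun setT h.
  apply: measurable_fun_pair; first exact: measurableT_comp.
  by apply: measurable_cons => //; exact: measurableT_comp.
by have := measurableT_comp (mF n.+1) mh.
Qed.

Lemma smeasurable_comp d' (U : measurableType d') d'' (V : measurableType d'')
    (g : U -> V) (F : V -> seq T -> \bar R) :
  measurable_fun setT g -> smeasurable F -> smeasurable (fun u => F (g u)).
Proof.
move=> mg mF n.
pose h (q : U * n.-tuple T) : V * n.-tuple T := (g q.1, q.2).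
have mh : measurable_fun setT h.
  by apply: measurable_fun_pair => //; exact: measurableT_comp.
by have := measurableT_comp (mF n) mh.
Qed.

Lemma measurable_uncons d' (U : measurableType d') n :
  measurable_fun setT (fun q : U * n.+1.-tuple T =>
    (q.1, thead q.2, [tuple of behead q.2] : n.-tuple T)).
Proof.
apply: measurable_fun_pair.
  apply: measurable_fun_pair => //.
  exact: (measurableT_comp (measurable_tnth ord0) measurable_snd).
exact: (measurableT_comp (@measurable_behead _ _ _) measurable_snd).
Qed.

Lemma smeasurable_uncons d' (U : measurableType d') (F : U -> seq T -> \bar R) :
  (forall u, F u [::] = 0) ->
  smeasurable (fun (p : U * T) s => F p.1 (p.2 :: s)) -> smeasurable F.
Proof.
move=> F0 mF [|n].
  rewrite (_ : (fun _ => _) = cst 0)//.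
  by apply/funext => -[u t] /=; rewrite tuple0.
pose h (q : U * n.+1.-tuple T) : U * T * n.-tuple T :=
  (q.1, thead q.2, [tuple of behead q.2]).
have mh : measurable_fun setT h by exact: measurable_uncons.
rewrite (_ : (fun _ => _) =
    (fun p : U * T * n.-tuple T => F p.1.1 (p.1.2 :: p.2)) \o h).
  exact: (measurableT_comp (mF n) mh).
apply/funext => -[u t] /=.
by rewrite [in LHS](tuple_eta t).
Qed.

Definition seqmeasurable (F : seq T -> \bar R) :=
  forall n, measurable_fun setT (fun t : n.-tuple T => F t).

Lemma smeasurable_at d' (U : measurableType d') (F : U -> seq T -> \bar R) u :
  smeasurable F -> seqmeasurable (F u).
Proof.
move=> mF n; pose h (t : n.-tuple T) : U * n.-tuple T := (u, t).
have mh : measurable_fun setT h by exact: measurable_fun_pair.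
exact: (measurableT_comp (mF n) mh).
Qed.

Lemma smeasurable_cst d' (U : measurableType d') (F : seq T -> \bar R) :
  seqmeasurable F -> smeasurable (fun _ : U => F).
Proof.
by move=> mF n; exact: (measurableT_comp (mF n) (@measurable_snd _ _ U _)).
Qed.

(** In [picks (a :: s)] every term but the first draws from [s] and leaves [a] at the head of the
    rest. This is that integrand with [a] as a parameter; sums over [picks] evaluate it on nonempty
    lists only. *)
Lemma smeasurable_swap d' (U : measurableType d') (F : U -> seq T -> \bar R) :
  smeasurable F ->
  smeasurable (fun (p : U * T) s => if s is z :: r then F p.1 (z :: p.2 :: r) else 0).
Proof.
move=> mF; apply: smeasurable_uncons => //=.
have := smeasurable_cons (smeasurable_cons mF).
pose h (q : U * T * T) := (q.1.1, q.2, q.1.2).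
move=> /(@smeasurable_comp _ _ _ _ h)/=; apply.
apply: measurable_fun_pair; last exact: measurableT_comp.
by apply: measurable_fun_pair => //; exact: measurableT_comp.
Qed.

Lemma smeasurable_picks d' (U : measurableType d') (F : U -> seq T -> \bar R) :
  smeasurable F -> smeasurable (fun u s => \sum_(p <- picks s) F u (p.1 :: p.2)).
Proof.
(* The parameter space varies in the induction, since the head of the list joins it at each step. *)
move=> + n; elim: n d' U F => [|n IH] d' U F mF.
  rewrite (_ : (fun _ => _) = cst 0)//.
  by apply/funext => -[u t] /=; rewrite tuple0 big_nil.
pose G (p : U * T) s := if s is z :: r then F p.1 (z :: p.2 :: r) else 0.
pose h (q : U * n.+1.-tuple T) : U * T * n.-tuple T :=
  (q.1, thead q.2, [tuple of behead q.2]).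
have mh : measurable_fun setT h by exact: measurable_uncons.
have mG : smeasurable G by exact: smeasurable_swap.
have mS := measurableT_comp (IH _ _ _ mG) mh.
rewrite (_ : (fun _ => _) = (fun p : U * n.+1.-tuple T => F p.1 p.2) \+
   ((fun p : U * T * n.-tuple T => \sum_(q <- picks p.2) G p.1 (q.1 :: q.2)) \o h)).
  by apply: emeasurable_funD; [exact: mF|exact: mS].
apply/funext => -[u t] /=.
rewrite (tuple_eta t) (@picks_cons _ _ (fun y r => F u (y :: r))) /=.
by rewrite theadE.
Qed.

Lemma smeasurable_selsum m d' (U : measurableType d') (F : U -> seq T -> \bar R) :
  smeasurable F -> smeasurable (fun u => selsum m (F u)).
Proof.
elim: m d' U F => [|m IH] d' U F mF //=.
pose g u s := if s is y :: r then selsum m (fun s => F u (y :: s)) r else 0.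
have mg : smeasurable g.
  by apply: smeasurable_uncons => //; exact: (IH _ _ _ (smeasurable_cons mF)).
exact: (smeasurable_picks mg).
Qed.

End MeasurableSequences.

Lemma selsum_ge0 (T : Type) (R : realType) m (F : seq T -> \bar R) x :
  (forall s, 0 <= F s) -> 0 <= selsum m F x.
Proof. by elim: m F x => //= m IH F x F0; apply: sume_ge0 => p _; exact: IH. Qed.

Lemma measurable_nneseries d (T : measurableType d) (R : realType)
    (h : (T -> \bar R)^nat) :
  (forall n x, 0 <= h n x) -> (forall n, measurable_fun setT (h n)) ->
  measurable_fun setT (fun x => \sum_(0 <= n <oo) h n x).
Proof.
move=> h0 mh.
rewrite (_ : (fun _ => _) = (fun x => \sum_(n <oo | n \in predT) h n x)).
  by apply: (ge0_emeasurable_sum (P := predT)).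
by apply/funext => x; exact: eq_eseriesl.
Qed.

(** * Weighted iterated integrals, the Poisson series and the Mecke formula *)

Section PoissonMecke.
Context {d} {T : measurableType d} {R : realType}.
Context (mu : {sigma_finite_measure set T -> \bar R}) (w : T -> R).
Context (mw : measurable_fun setT w) (w0 : forall y, (0 <= w y)%R).

Let mwE : measurable_fun setT (fun y => (w y)%:E).
Proof. exact/measurable_EFinP. Qed.

Let wE0 y : 0 <= (w y)%:E.
Proof. by rewrite lee_fin. Qed.

(** Integration against the intensity, as a density [w] on a sigma-finite measure; domains of
    integration go into [w], so that every integral runs over the whole space. *)
Definition wint (f : T -> \bar R) : \bar R := \int[mu]_y ((w y)%:E * f y).

Lemma wint_ge0 f : (forall y, 0 <= f y) -> 0 <= wint f.
Proof. by move=> f0; apply: integral_ge0 => y _; exact: mule_ge0. Qed.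

Lemma measurable_wint d' (U : measurableType d') (f : U * T -> \bar R) :
  measurable_fun setT f -> (forall p, 0 <= f p) ->
  measurable_fun setT (fun u => wint (fun y => f (u, y))).
Proof.
move=> mf f0.
apply: (@measurable_fun_fubini_tonelli_F _ _ _ _ _ _ (fun p => (w p.2)%:E * f p)).
- apply: emeasurable_funM => //.
  exact: (measurableT_comp mwE measurable_snd).
- by move=> p; exact: mule_ge0.
Qed.

Lemma wint_swap (f : T * T -> \bar R) :
  measurable_fun setT f -> (forall p, 0 <= f p) ->
  wint (fun x => wint (fun y => f (x, y))) = wint (fun y => wint (fun x => f (x, y))).
Proof.
move=> mf f0; rewrite /wint.
transitivity (\int[mu]_x \int[mu]_y ((w x)%:E * ((w y)%:E * f (x, y)))).
  apply: eq_integral => x _; rewrite ge0_integralZl//.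
  - apply: emeasurable_funM => //.
    exact: (measurableT_comp mf (measurable_pair1 x)).
  - by move=> y _; exact: mule_ge0.
rewrite (fubini_tonelli (fun p => (w p.1)%:E * ((w p.2)%:E * f p))).
- apply: eq_integral => y _; rewrite -ge0_integralZl//.
  + by apply: eq_integral => x _; rewrite muleCA.
  + apply: emeasurable_funM => //.
    exact: (measurableT_comp mf (measurable_pair2 y)).
  + by move=> x _; exact: mule_ge0.
- apply: emeasurable_funM.
    exact: (measurableT_comp mwE measurable_fst).
  apply: emeasurable_funM => //.
  exact: (measurableT_comp mwE measurable_snd).
- by move=> p; rewrite !mule_ge0.
Qed.

Lemma wintZ k f : measurable_fun setT f -> (forall y, 0 <= f y) -> 0 <= k ->
  wint (fun y => k * f y) = k * wint f.
Proof.
move=> mf f0 k0; rewrite /wint -ge0_integralZl//.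
- by apply: eq_integral => y _; rewrite muleCA.
- exact: emeasurable_funM.
- by move=> y _; exact: mule_ge0.
Qed.

Lemma wintD f g : measurable_fun setT f -> measurable_fun setT g ->
  (forall y, 0 <= f y) -> (forall y, 0 <= g y) ->
  wint (fun y => f y + g y) = wint f + wint g.
Proof.
move=> mf mg f0 g0; rewrite /wint -ge0_integralD//.
- by apply: eq_integral => y _; rewrite ge0_muleDr.
- by move=> y _; exact: mule_ge0.
- exact: emeasurable_funM.
- by move=> y _; exact: mule_ge0.
- exact: emeasurable_funM.
Qed.

Lemma wint_nneseries (f : (T -> \bar R)^nat) :
  (forall n, measurable_fun setT (f n)) -> (forall n y, 0 <= f n y) ->
  wint (fun y => \sum_(0 <= n <oo) f n y) = \sum_(0 <= n <oo) wint (f n).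
Proof.
move=> mf f0; rewrite /wint -integral_nneseries//.
- by apply: eq_integral => y _; rewrite nneseriesZl.
- by move=> n; exact: emeasurable_funM.
- by move=> n y _; exact: mule_ge0.
Qed.

Fixpoint iter_wint (n : nat) (F : seq T -> \bar R) : \bar R :=
  if n is k.+1 then wint (fun y => iter_wint k (fun s => F (y :: s))) else F [::].

Lemma iter_wint_ge0 n F : (forall s, 0 <= F s) -> 0 <= iter_wint n F.
Proof.
by elim: n F => //= n IH F F0; apply: wint_ge0 => y; exact: IH.
Qed.

Lemma eq_iter_wint n F G : (forall s, size s = n -> F s = G s) ->
  iter_wint n F = iter_wint n G.
Proof.
elim: n F G => [|n IH] F G FG /=; first exact: FG.
by congr wint; apply/funext => y; apply: IH => s sn; apply: FG; rewrite /= sn.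
Qed.

Lemma measurable_iter_wint n d' (U : measurableType d') (F : U -> seq T -> \bar R) :
  smeasurable F -> (forall u s, 0 <= F u s) ->
  measurable_fun setT (fun u => iter_wint n (F u)).
Proof.
elim: n d' U F => [|n IH] d' U F mF F0 /=.
  pose h (u : U) : U * 0.-tuple T := (u, [tuple]).
  have mh : measurable_fun setT h by exact: measurable_fun_pair.
  exact: (measurableT_comp (mF 0%N) mh).
have mG := IH _ _ _ (smeasurable_cons mF) (fun p s => F0 p.1 _).
by apply: (measurable_wint mG) => p; exact: iter_wint_ge0.
Qed.

Lemma seqmeasurable_cons (F : seq T -> \bar R) :
  seqmeasurable F -> smeasurable (fun y s => F (y :: s)).
Proof.
move=> mF n; pose h (p : T * n.-tuple T) := [the n.+1.-tuple T of p.1 :: p.2].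
have mh : measurable_fun setT h by exact: measurable_cons.
exact: (measurableT_comp (mF n.+1) mh).
Qed.

Lemma iter_wintZ n k F : seqmeasurable F -> (forall s, 0 <= F s) -> 0 <= k ->
  iter_wint n (fun s => k * F s) = k * iter_wint n F.
Proof.
elim: n F => //= n IH F mF F0 k0; have mF' := seqmeasurable_cons mF.
rewrite -wintZ//; last by move=> y; exact: iter_wint_ge0.
  by congr wint; apply/funext => y; rewrite IH//; exact: smeasurable_at mF'.
exact: measurable_iter_wint.
Qed.

Lemma iter_wintD n F G : seqmeasurable F -> seqmeasurable G ->
  (forall s, 0 <= F s) -> (forall s, 0 <= G s) ->
  iter_wint n (fun s => F s + G s) = iter_wint n F + iter_wint n G.
Proof.
elim: n F G => //= n IH F G mF mG F0 G0.
have mF' := seqmeasurable_cons mF; have mG' := seqmeasurable_cons mG.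
rewrite -wintD; first last.
- by move=> y; exact: iter_wint_ge0.
- by move=> y; exact: iter_wint_ge0.
- exact: measurable_iter_wint.
- exact: measurable_iter_wint.
congr wint; apply/funext => y; rewrite IH//.
  exact: smeasurable_at mF'.
exact: smeasurable_at mG'.
Qed.

(* By symmetry of the product measure every entry may be moved to the front. *)
Lemma iter_wint_picks n F : seqmeasurable F -> (forall s, 0 <= F s) ->
  iter_wint n (fun s => \sum_(p <- picks s) F (p.1 :: p.2)) =
  n%:R%:E * iter_wint n F.
Proof.
elim: n F => [|n IH] F mF F0; first by rewrite /= big_nil mul0e.
have mF' := seqmeasurable_cons mF.
pose G y s := if s is z :: r then F (z :: y :: r) else 0.
have G0 y s : 0 <= G y s by case: s => [|z r] //=.
have mG : smeasurable G.
  pose h (y : T) := (tt, y).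
  have mh : measurable_fun setT h by exact: measurable_fun_pair.
  exact: (smeasurable_comp mh (smeasurable_swap (@smeasurable_cst _ _ _ _ unit _ mF))).
have mGp : smeasurable (fun y s => \sum_(p <- picks s) G y (p.1 :: p.2)).
  exact: smeasurable_picks.
transitivity (wint (fun y => iter_wint n (fun s => F (y :: s)) +
    n%:R%:E * iter_wint n (G y))).
  congr wint; apply/funext => y; rewrite -IH//; last exact: smeasurable_at mG.
  rewrite -iter_wintD//; last 3 first.
  - exact: smeasurable_at mF'.
  - exact: smeasurable_at mGp.
  - by move=> s; exact: sume_ge0.
  apply: eq_iter_wint => s _.
  by rewrite (@picks_cons _ _ (fun y r => F (y :: r))).
rewrite wintD//; last 4 first.
- exact: measurable_iter_wint.
- by apply: measurable_funeM; exact: measurable_iter_wint.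
- by move=> y; exact: iter_wint_ge0.
- by move=> y; rewrite mule_ge0// ?lee_fin// iter_wint_ge0.
rewrite wintZ//; last 2 first.
- exact: measurable_iter_wint.
- by move=> y; exact: iter_wint_ge0.
rewrite -nat1r EFinD ge0_muleDl ?lee_fin// mul1e; congr (_ + _).
(* For [n = 0] both sides carry the factor 0. Otherwise [G y] splits off a drawn head, which Tonelli
   exchanges with [y]. *)
case: n {IH} => [|n] in mGp *; first by rewrite !mul0e.
congr (_ * _); rewrite /= (@wint_swap (fun p => iter_wint n (fun r => F (p.2 :: p.1 :: r))))//.
  pose h (p : T * T) := (p.2, p.1).
  have mh : measurable_fun setT h by exact: measurable_fun_pair.
  apply: (measurableT_comp _ mh (f := fun p => iter_wint n (fun r => F (p.1 :: p.2 :: r)))).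
  by apply: measurable_iter_wint => //; exact: (smeasurable_cons mF').
by move=> p; exact: iter_wint_ge0.
Qed.

Context (c : R) (c0 : (0 <= c)%R).

(** The constant [c] will be [exp(-lambda(Y))]; the identities below are linear in it. *)
Definition poisson_int (F : seq T -> \bar R) : \bar R :=
  c%:E * \sum_(0 <= n <oo) ((n`!%:R)^-1)%:E * iter_wint n F.

Lemma poisson_int_ge0 F : (forall s, 0 <= F s) -> 0 <= poisson_int F.
Proof.
move=> F0; apply: mule_ge0; first by rewrite lee_fin.
by apply: nneseries_ge0 => n _ _; rewrite mule_ge0// iter_wint_ge0.
Qed.

Lemma poisson_intZ (k : R) F : seqmeasurable F -> (forall s, 0 <= F s) ->
  (0 <= k)%R -> poisson_int (fun s => k%:E * F s) = k%:E * poisson_int F.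
Proof.
move=> mF F0 k0; rewrite /poisson_int muleCA; congr (_ * _).
rewrite -nneseriesZl; last by move=> n _; rewrite mule_ge0// iter_wint_ge0.
by apply: eq_eseriesr => n _; rewrite iter_wintZ ?lee_fin// muleCA.
Qed.

Lemma poisson_intD F G : seqmeasurable F -> seqmeasurable G ->
  (forall s, 0 <= F s) -> (forall s, 0 <= G s) ->
  poisson_int (fun s => F s + G s) = poisson_int F + poisson_int G.
Proof.
move=> mF mG F0 G0; rewrite /poisson_int -ge0_muleDr; last 2 first.
- by apply: nneseries_ge0 => n _ _; rewrite mule_ge0// iter_wint_ge0.
- by apply: nneseries_ge0 => n _ _; rewrite mule_ge0// iter_wint_ge0.
rewrite -nneseriesD//; last 2 first.
- by move=> n _ _; rewrite mule_ge0// iter_wint_ge0.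
- by move=> n _ _; rewrite mule_ge0// iter_wint_ge0.
congr (_ * _); apply: eq_eseriesr => n _.
by rewrite iter_wintD// ge0_muleDr// iter_wint_ge0.
Qed.

Lemma measurable_poisson_int d' (U : measurableType d') (F : U -> seq T -> \bar R) :
  smeasurable F -> (forall u s, 0 <= F u s) ->
  measurable_fun setT (fun u => poisson_int (F u)).
Proof.
move=> mF F0; apply: measurable_funeM.
apply: (measurable_nneseries
  (h := fun n u => ((n`!%:R)^-1)%:E * iter_wint n (F u))) => n *.
  by rewrite mule_ge0// iter_wint_ge0.
by apply: measurable_funeM; exact: measurable_iter_wint.
Qed.

Lemma mecke_formula F : seqmeasurable F -> (forall s, 0 <= F s) ->
  poisson_int (fun s => \sum_(p <- picks s) F (p.1 :: p.2)) =
  wint (fun y => poisson_int (fun s => F (y :: s))).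
Proof.
move=> mF F0; have mF' := seqmeasurable_cons mF.
have mI n : measurable_fun setT (fun y => iter_wint n (fun s => F (y :: s))).
  exact: measurable_iter_wint.
rewrite /poisson_int wintZ//; last 2 first.
- apply: (measurable_nneseries (h := fun n y =>
    ((n`!%:R)^-1)%:E * iter_wint n (fun s => F (y :: s)))) => n *; last exact: measurable_funeM.
  by rewrite mule_ge0// iter_wint_ge0.
- by move=> y; apply: nneseries_ge0 => n _ _; rewrite mule_ge0// iter_wint_ge0.
congr (_ * _); rewrite wint_nneseries; last 2 first.
- by move=> n; exact: measurable_funeM.
- by move=> n y; rewrite mule_ge0// iter_wint_ge0.
have sum_ge0 n : 0 <= ((n`!%:R)^-1)%:E *
    iter_wint n (fun s => \sum_(p <- picks s) F (p.1 :: p.2)).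
  by rewrite mule_ge0// iter_wint_ge0// => s; exact: sume_ge0.
(* Nothing can be drawn from the empty configuration, so the term of index 0 vanishes; after the
   shift, [(n+1)/(n+1)! = 1/n!]. *)
rewrite [LHS]nneseries_recl// [in LHS]/= big_nil mule0 add0e -[LHS]nneseries_addn//.
apply: eq_eseriesr => n _; rewrite addn1 iter_wint_picks// wintZ//; last first.
  by move=> y; exact: iter_wint_ge0.
rewrite muleA -EFinM factS natrM invfM mulrAC mulVf ?mul1r//.
Qed.

(** The multivariate Mecke formula: after the one-point formula has fixed the first draw, the
    induction treats the remaining draws with that point as a prefix. *)
Lemma poisson_int_selsum m F : seqmeasurable F -> (forall s, 0 <= F s) ->
  poisson_int (selsum m F) =
  iter_wint m (fun ys => poisson_int (fun s => F (ys ++ s))).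
Proof.
elim: m F => //= m IH F mF F0; have mF' := seqmeasurable_cons mF.
pose G s := if s is y :: r then selsum m (fun s => F (y :: s)) r else 0.
have G0 s : 0 <= G s by case: s => //= y s; exact: selsum_ge0.
have mG : seqmeasurable G.
  suff : smeasurable (fun _ : unit => G) by move=> /(smeasurable_at tt).
  apply: smeasurable_uncons => //=.
  exact: (smeasurable_selsum m (smeasurable_comp (@measurable_snd _ _ unit T) mF')).
have := mecke_formula mG G0; rewrite /G => ->.
by congr wint; apply/funext => y; rewrite IH//; exact: smeasurable_at mF'.
Qed.

End PoissonMecke.

(** * The intensity measure as a weight on a sigma-finite product *)

Lemma integral_indicM d (T : measurableType d) (R : realType)
    (m : {measure set T -> \bar R}) (D : set T) (k : R) (g : T -> \bar R) :
  measurable D -> measurable_fun setT g -> (forall x, 0 <= g x) -> (0 <= k)%R ->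
  \int[m]_x ((k * \1_D x)%:E * g x) = k%:E * \int[m]_(x in D) g x.
Proof.
move=> mD mg g0 k0; rewrite -ge0_integralZl_EFin//; last exact: measurable_funS mg.
rewrite [RHS]integral_mkcond; apply: eq_integral => x _; rewrite patchE indicE.
by case: ifPn => _; rewrite ?mulr1// mulr0 mul0e.
Qed.

Section SigmaFiniteProduct.
Context d1 d2 (T1 : measurableType d1) (T2 : measurableType d2) (R : realType).
Context (m1 : {sigma_finite_measure set T1 -> \bar R}).
Context (m2 : {sigma_finite_measure set T2 -> \bar R}).

(* The library makes products canonically sigma-finite only for
   subprobabilities, hence this copy of the product measure. *)
Definition sfprod : set (T1 * T2) -> \bar R := m1 \x m2.

HB.instance Definition _ := Measure.on sfprod.

Let sigma_finite_sfprod : sigma_finite setT sfprod.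
Proof.
have [F FT mF] := sigma_finiteT m1; have [G GT mG] := sigma_finiteT m2.
(* The rectangles [F i x G j] are enumerated by the pairing code; numbers that code no pair
   contribute the empty set. *)
exists (fun n => if unpickle n is Some (i, j) then F i `*` G j else set0).
  apply/seteqP; split => // -[x y] _.
  have [i _ Fx] : (\bigcup_i F i) x by rewrite -FT.
  have [j _ Gy] : (\bigcup_i G i) y by rewrite -GT.
  by exists (pickle (i, j)) => //=; rewrite pickleK.
move=> n; case: unpickle => [[i j]|]; last by rewrite measure0.
have [mFi Fi] := mF i; have [mGj Gj] := mG j; split; first exact: measurableX.
by rewrite /sfprod product_measure1E// lte_mul_pinfty// ge0_fin_numE.
Qed.

HB.instance Definition _ := Measure_isSigmaFinite.Build _ _ _ sfprod sigma_finite_sfprod.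

End SigmaFiniteProduct.

Section PlateIntegral.
Context {R : realType} (B : set (@pt R)) (rho : @pt R -> R) (b : R).
Context (Q : probability R R) (V : probability (@pt R) R).
Context (mB : measurable B) (mrho : measurable_fun setT rho)
  (rho0 : forall z, (0 <= rho z)%R).

Let leb : {sigma_finite_measure set (measurableTypeR R) -> \bar R} := @lebesgue_measure R.

(* [plate_ref] lives on the sigma-algebra of [measurableTypeR R], which is
   convertible to that of [R] but has another display. *)
Definition plate_ref := sfprod (sfprod (sfprod (sfprod leb leb) leb) Q) V.

Definition plate_weight (y : @plate R) : R :=
  (rho (pcentre y) * \1_B (pcentre y) * \1_`]0%R, b] (pradius y) *
   \1_hemisphere (pnormal y))%R.

Lemma measurable_hemisphere : measurable (@hemisphere R).
Proof.
have m1 : measurable_fun setT (fun p : @pt R => p.1.1) by apply: measurableT_comp.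
have m2 : measurable_fun setT (fun p : @pt R => p.1.2) by apply: measurableT_comp.
have m3 : measurable_fun setT (fun p : @pt R => p.2) by exact: measurable_snd.
have md : measurable_fun setT (fun p : @pt R => dot p p).
  by apply: measurable_funD; first apply: measurable_funD; exact: measurable_funM.
rewrite (_ : hemisphere = (setT `&` (fun p => dot p p) @^-1` [set 1%R]) `&`
  (setT `&` (fun p => p.2) @^-1` `[0%R, +oo[)).
  by apply: measurableI; [exact: md|exact: m3].
apply/seteqP; split=> p; rewrite /hemisphere /= in_itv /= andbT.
  by move=> [p1 p2]; rewrite -sqr_enorm p1 expr1n.
move=> [[_ p1] [_ p2]]; split=> //.
by rewrite /enorm p1 sqrtr1.
Qed.

Lemma measurable_plate_weight : measurable_fun setT plate_weight.
Proof.
have mz : measurable_fun setT (@pcentre R) by apply: measurableT_comp.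
have mr : measurable_fun setT (@pradius R) by apply: measurableT_comp.
have mp : measurable_fun setT (@pnormal R) by exact: measurable_snd.
have m1 d (T : measurableType d) (D : set T) (f : @plate R -> T) : measurable D ->
    measurable_fun setT f -> measurable_fun setT (fun y => \1_D (f y) : R).
  by move=> mD mf; exact: (measurableT_comp (measurable_indic mD) mf).
apply: measurable_funM; last exact: (m1 _ _ _ _ measurable_hemisphere mp).
apply: measurable_funM; last by apply: (m1 _ _ _ _ _ mr); exact: measurable_itv.
by apply: measurable_funM; [exact: (measurableT_comp mrho mz)|exact: (m1 _ _ _ _ mB mz)].
Qed.

Lemma plate_weight_ge0 y : (0 <= plate_weight y)%R.
Proof. by rewrite /plate_weight !mulr_ge0. Qed.

(** Tonelli peels off the normal and then the radius: [g] is the inner integral over the hemisphere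
    and [k] the weight without its hemisphere factor. Each restricted domain reappears as an
    indicator. *)
Lemma intY_wint (f : @plate R -> \bar R) :
  measurable_fun setT f -> (forall y, 0 <= f y) ->
  intY B rho b Q V f = wint plate_ref plate_weight f.
Proof.
move=> mf f0.
have mh := measurable_hemisphere.
have mWf : measurable_fun setT (fun y => (plate_weight y)%:E * f y).
  apply: emeasurable_funM => //; apply/measurable_EFinP.
  exact: measurable_plate_weight.
have Wf0 y : 0 <= (plate_weight y)%:E * f y.
  by rewrite mule_ge0// lee_fin plate_weight_ge0.
pose g (zr : @pt R * R) := \int[V]_(phi in hemisphere) f (zr, phi).
have g0 zr : 0 <= g zr by apply: integral_ge0.
have mfzr zr : measurable_fun setT (fun phi => f (zr, phi)).
  exact: (measurableT_comp mf (measurable_pair1 zr)).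
have mg : measurable_fun setT g.
  rewrite (_ : g = fun zr => \int[V]_phi ((1 * \1_hemisphere phi)%:E * f (zr, phi))).
    apply: (@measurable_fun_fubini_tonelli_F _ _ _ _ _ _
      (fun y : @plate R => (1 * \1_hemisphere y.2)%:E * f y)) => //.
      apply: emeasurable_funM => //; apply/measurable_EFinP.
      apply: measurable_funM; first exact: measurable_cst.
      exact: (measurableT_comp (measurable_indic mh) measurable_snd).
    by move=> y; rewrite mule_ge0// lee_fin mulr_ge0.
  by apply/funext => zr; rewrite integral_indicM// mul1e.
pose k (zr : @pt R * R) : R := (rho zr.1 * \1_B zr.1 * \1_`]0%R, b] zr.2)%R.
have k0 zr : (0 <= k zr)%R by rewrite /k !mulr_ge0.
have mk : measurable_fun setT k.
  have m1 d (T : measurableType d) (D : set T) (h : @pt R * R -> T) : measurable D ->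
      measurable_fun setT h -> measurable_fun setT (fun zr => \1_D (h zr) : R).
    by move=> mD mh'; exact: (measurableT_comp (measurable_indic mD) mh').
  apply: measurable_funM; last first.
    by apply: (m1 _ _ _ _ _ measurable_snd); exact: measurable_itv.
  apply: measurable_funM; first exact: (measurableT_comp mrho measurable_fst).
  exact: (m1 _ _ _ _ mB measurable_fst).
rewrite /wint (fubini_tonelli1 (m1 := sfprod (sfprod (sfprod leb leb) leb) Q) (m2 := V)
  (fun y => (plate_weight y)%:E * f y))//=.
transitivity (\int[sfprod (sfprod (sfprod leb leb) leb) Q]_zr ((k zr)%:E * g zr)); last first.
  apply: eq_integral => zr _ /=; rewrite /g -integral_indicM//.
rewrite (fubini_tonelli1 (m1 := sfprod (sfprod leb leb) leb) (m2 := Q)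
  (fun zr => (k zr)%:E * g zr)); last 2 first.
- by apply: emeasurable_funM => //; exact/measurable_EFinP.
- by move=> zr; rewrite mule_ge0// lee_fin.
rewrite /intY [LHS]integral_mkcond; apply: eq_integral => z _ /=.
rewrite patchE /= /k /= /fubini_F /=.
rewrite integral_indicM//.
- rewrite indicE; case: ifPn => _; first by rewrite mulr1.
  by rewrite mulr0 mul0e.
- exact: (measurableT_comp mg (measurable_pair1 z)).
- by rewrite mulr_ge0.
Qed.

End PlateIntegral.

(** * Symmetric weights, and measurable integrands on tuples of plates *)

Lemma measurable_cat_tuple d (T : measurableType d) k n :
  measurable_fun setT (fun p : k.-tuple T * n.-tuple T =>
    [tuple of p.1 ++ p.2] : (k + n).-tuple T).
Proof.
apply/measurable_fun_tnthP => i; have [ik|ki] := ltnP i k.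
  rewrite (_ : _ \o _ = (fun t : k.-tuple T => tnth t (Ordinal ik)) \o fst).
    exact: (measurableT_comp (measurable_tnth _) measurable_fst).
  apply/funext => p /=; pose x0 := tnth p.1 (Ordinal ik).
  by rewrite !(tnth_nth x0) /= nth_cat size_tuple ik.
have ikn : (i - k < n)%N by rewrite ltn_subLR.
rewrite (_ : _ \o _ = (fun t : n.-tuple T => tnth t (Ordinal ikn)) \o snd).
  exact: (measurableT_comp (measurable_tnth _) measurable_snd).
apply/funext => p /=; pose x0 := tnth p.2 (Ordinal ikn).
by rewrite !(tnth_nth x0) /= nth_cat size_tuple ltnNge ki.
Qed.

Lemma EFin_selsum (T : Type) (R : realType) m (h : seq T -> R) x :
  (selsum m h x)%:E = selsum m (fun s => (h s)%:E) x.
Proof.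
by elim: m h x => //= m IH h x; rewrite -sumEFin; apply: eq_bigr => p _.
Qed.

(** Drawing merely permutes the configuration, so a symmetric weight takes the same value on every
    term. This carries the Gibbs density into and out of selections. *)
Lemma selsum_mulr (T : eqType) (R : realType) m (h w : seq T -> R) x :
  (forall s r, perm_eq s r -> w s = w r) ->
  selsum m (fun s => h s * w s)%R x = (selsum m h x * w x)%R.
Proof.
elim: m h w x => //= m IH h w x wP; rewrite mulr_suml; apply: eq_big_seq => p px.
rewrite IH; last by move=> s r sr; apply: wP; rewrite perm_cons.
by rewrite (wP _ _ (picks_perm px)).
Qed.

Section MeasurablePlateFunctionals.
Context {R : realType}.
Local Open Scope ring_scope.

Lemma measurable_nthp n i :
  measurable_fun setT (fun t : n.-tuple (@plate R) => nthp t i).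
Proof.
have [it|ti] := ltnP i n.
  rewrite (_ : (fun _ => _) = (fun t : n.-tuple (@plate R) => tnth t (Ordinal it))).
    exact: measurable_tnth.
  by apply/funext => t; rewrite (tnth_nth dflt_plate).
rewrite (_ : (fun _ => _) = cst dflt_plate); first exact: measurable_cst.
by apply/funext => t; rewrite /nthp nth_default// size_tuple.
Qed.

Lemma measurable_area_nthp n i :
  measurable_fun setT (fun t : n.-tuple (@plate R) => area (nthp t i)).
Proof.
have mr : measurable_fun setT (@pradius R) by apply: measurableT_comp.
apply: measurable_funM; first exact: measurable_cst.
by apply: measurable_funX; exact: (measurableT_comp mr (measurable_nthp i)).
Qed.

Lemma measurable_isect_len_nthp n i j :
  measurable_fun setT (fun t : n.-tuple (@plate R) => isect_len (nthp t i) (nthp t j)).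
Proof.
have mij := measurable_fun_pair (measurable_nthp (n := n) i) (measurable_nthp j).
exact: (measurableT_comp measurable_isect_len mij).
Qed.

Lemma measurable_tri_nthp n i j k :
  measurable_fun setT (fun t : n.-tuple (@plate R) =>
    tri (nthp t i) (nthp t j) (nthp t k)).
Proof.
have mij := measurable_fun_pair (measurable_nthp (n := n) i) (measurable_nthp j).
have mijk := measurable_fun_pair mij (measurable_nthp k).
exact: (measurableT_comp measurable_tri mijk).
Qed.

Lemma measurable_nuG n (nu1 nu2 nu3 : R) :
  measurable_fun setT (fun t : n.-tuple (@plate R) => nuG nu1 nu2 nu3 t).
Proof.
rewrite (_ : (fun _ => _) = fun t : n.-tuple (@plate R) =>
  nu1 * (\sum_(i < n) area (nthp t i)) +
  nu2 * (\sum_(i < n) \sum_(j <- [seq j : 'I_n <- index_enum _ | (i < j)%N])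
    isect_len (nthp t i) (nthp t j)) +
  nu3 * (\sum_(i < n) \sum_(j < n) \sum_(k <- [seq k : 'I_n <- index_enum _ | (i < j)%N && (j < k)%N])
    tri (nthp t i) (nthp t j) (nthp t k))).
  apply: measurable_funD; first apply: measurable_funD.
  - apply: measurable_funM; first exact: measurable_cst.
    by apply: measurable_sum => i; exact: measurable_area_nthp.
  - apply: measurable_funM; first exact: measurable_cst.
    do 2 apply: measurable_sum => ?; exact: measurable_isect_len_nthp.
  - apply: measurable_funM; first exact: measurable_cst.
    do 3 apply: measurable_sum => ?; exact: measurable_tri_nthp.
apply/funext => t; rewrite /nuG Stot_sum Ltot_psum Ntot_tsum.
rewrite -(sum_nth dflt_plate) -(sum_nth_ltn dflt_plate) -(sum_nth_ltn3 dflt_plate).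
rewrite size_tuple; congr (_ + _ * _ + _ * _); apply: eq_bigr => i _.
  by rewrite big_filter.
by apply: eq_bigr => j _; rewrite big_filter.
Qed.

End MeasurablePlateFunctionals.

Lemma seqmeasurable_selsum d (T : measurableType d) (R : realType) m
    (F : seq T -> \bar R) : seqmeasurable F -> seqmeasurable (selsum m F).
Proof.
by move=> /(smeasurable_cst (U := unit))/(smeasurable_selsum m)/(smeasurable_at tt).
Qed.

Section Admissible.
Context {R : realType}.
Local Open Scope ring_scope.
Implicit Types (f g h : seq (@plate R) -> R) (k : R) (m i j : nat).

Definition admissible f := (forall s, 0 <= f s) /\
  forall n, measurable_fun setT (fun t : n.-tuple (@plate R) => f t).

(** With this, the factor attached to the drawn points is constant under the expectation over the
    points appended behind them. *)
Definition depends_on_prefix m f := forall s r, size s = m -> f (s ++ r) = f s.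

Lemma admissibleD f g : admissible f -> admissible g ->
  admissible (fun s => f s + g s).
Proof.
move=> [f0 mf] [g0 mg]; split=> [s|n]; first exact: addr_ge0.
by apply: measurable_funD; [exact: mf|exact: mg].
Qed.

Lemma admissibleM f g : admissible f -> admissible g ->
  admissible (fun s => f s * g s).
Proof.
move=> [f0 mf] [g0 mg]; split=> [s|n]; first exact: mulr_ge0.
by apply: measurable_funM; [exact: mf|exact: mg].
Qed.

Lemma admissibleZ k f : 0 <= k -> admissible f -> admissible (fun s => k * f s).
Proof.
move=> k0 [f0 mf]; split=> [s|n]; first exact: mulr_ge0.
by apply: measurable_funM; [exact: measurable_cst|exact: mf].
Qed.

Lemma admissible_selsum m h : admissible h -> admissible (selsum m h).
Proof.
move=> [h0 mh]; split=> [s|n].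
  by rewrite -lee_fin EFin_selsum selsum_ge0// => r; rewrite lee_fin.
apply/measurable_EFinP.
have /(seqmeasurable_selsum m)/(_ n) : seqmeasurable (fun s => (h s)%:E).
  by move=> k; apply/measurable_EFinP; exact: mh.
by congr measurable_fun; apply/funext => t; rewrite -EFin_selsum.
Qed.

Lemma admissible_area i : admissible (fun s => area (nthp s i)).
Proof.
split=> [s|n]; first by rewrite /area mulr_ge0 ?pi_ge0 ?sqr_ge0.
exact: measurable_area_nthp.
Qed.

Lemma admissible_isect_len i j :
  admissible (fun s => isect_len (nthp s i) (nthp s j)).
Proof.
split=> [s|n]; [exact: isect_len_ge0|exact: measurable_isect_len_nthp].
Qed.

Lemma admissible_tri i j m :
  admissible (fun s => tri (nthp s i) (nthp s j) (nthp s m)).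
Proof. by split=> [s|n]; [exact: tri_ge0|exact: measurable_tri_nthp]. Qed.

End Admissible.

(** * Gibbs expectations of selection sums *)

Section GibbsMoments.
Context {R : realType} (B : set (@pt R)) (rho : @pt R -> R) (b : R).
Context (Q : probability R R) (V : probability (@pt R) R).
Context (mB : measurable B) (mrho : measurable_fun setT rho)
  (rho0 : forall z, (0 <= rho z)%R).
Context (nu1 nu2 nu3 : R).

Let mu := plate_ref Q V.
Let w := plate_weight B rho b.
Let c : R := expR (- fine (lamY B rho b Q V)).
Let p := gibbs_density B rho b Q V nu1 nu2 nu3.
Let mw : measurable_fun setT w. Proof. exact: measurable_plate_weight. Qed.
Let w0 y : (0 <= w y)%R. Proof. exact: plate_weight_ge0. Qed.

Let c0 : (0 <= c)%R. Proof. exact: expR_ge0. Qed.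

Lemma intYn_ge0 n (F : seq (@plate R) -> \bar R) :
  (forall s, 0 <= F s) -> 0 <= intYn B rho b Q V n F.
Proof.
elim: n F => //= n IH F F0; apply: integral_ge0 => z _.
rewrite mule_ge0 ?lee_fin//; apply: integral_ge0 => r _.
by apply: integral_ge0 => phi _; exact: IH.
Qed.

Lemma intYn_iter_wint n (F : seq (@plate R) -> \bar R) :
  seqmeasurable F -> (forall s, 0 <= F s) ->
  intYn B rho b Q V n F = iter_wint mu w n F.
Proof.
elim: n F => //= n IH F mF F0; have mF' := seqmeasurable_cons mF.
have -> : (fun y => intYn B rho b Q V n (fun s => F (y :: s))) =
    (fun y => iter_wint mu w n (fun s => F (y :: s))).
  by apply/funext => y; rewrite IH//; exact: smeasurable_at mF'.
rewrite intY_wint//.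
  exact: (@measurable_iter_wint _ _ R mu w mw w0 n _ (@plate R)
    (fun y s => F (y :: s)) mF').
by move=> y; apply: iter_wint_ge0 => // s.
Qed.

Lemma Epois_poisson_int (F : seq (@plate R) -> \bar R) :
  seqmeasurable F -> (forall s, 0 <= F s) ->
  Epois B rho b Q V F = poisson_int mu w c F.
Proof.
move=> mF F0; congr (_ * _); apply: eq_eseriesr => n _.
by rewrite intYn_iter_wint.
Qed.


Let p_ge0 s : (0 <= p s)%R.
Proof.
rewrite /p /gibbs_density mulr_ge0 ?expR_ge0// invr_ge0 fine_ge0//.
rewrite /cnu /Epois mule_ge0// ?lee_fin ?expR_ge0//.
by apply: nneseries_ge0 => n _ _; rewrite mule_ge0// ?lee_fin// intYn_ge0.
Qed.

Let seqmeasurable_p : seqmeasurable (fun s => (p s)%:E).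
Proof.
move=> n; apply/measurable_EFinP.
apply: measurable_funM; first exact: measurable_cst.
by apply: measurableT_comp => //; exact: measurable_nuG.
Qed.

Let smeasurable_p k :
  smeasurable (fun (ys : k.-tuple (@plate R)) s => (p (ys ++ s))%:E).
Proof.
move=> n; have mc := @measurable_cat_tuple _ (@plate R) k n.
exact: (measurableT_comp (@seqmeasurable_p (k + n)%N) mc).
Qed.

Let Eg := Egibbs B rho b Q V nu1 nu2 nu3.

(** [calE] is the conditional intensity: multiplied by the density at [x] it gives the density at
    [ys ++ x], with the same normalizing constant on both sides. *)
Let Eg_calE ys : Eg (fun x => (calE nu1 nu2 nu3 x ys)%:E) =
  Epois B rho b Q V (fun x => (p (ys ++ x))%:E).
Proof.
rewrite /Eg /Egibbs; congr Epois; apply/funext => x.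
by rewrite /p /gibbs_density -EFinM mulrCA calE_expR.
Qed.

(** The iterated Georgii-Nguyen-Zessin equation: multivariate Mecke applied to [h] times the Gibbs
    density, whose value on the enlarged configuration is absorbed by [calE]. *)
Lemma Egibbs_selsum m (h : seq (@plate R) -> R) :
  depends_on_prefix m h -> admissible h ->
  Eg (fun x => (selsum m h x)%:E) =
  intYn B rho b Q V m
    (fun ys => Eg (fun x => (calE nu1 nu2 nu3 x ys)%:E) * (h ys)%:E).
Proof.
move=> hm [h0 mh].
have mhp : seqmeasurable (fun s => (h s * p s)%:E).
  move=> n; apply/measurable_EFinP; apply: measurable_funM; first exact: mh.
  by apply/measurable_EFinP; exact: seqmeasurable_p.
have hp0 s : 0 <= (h s * p s)%:E by rewrite lee_fin mulr_ge0.
have mps ys : seqmeasurable (fun s => (p (ys ++ s))%:E).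
  exact: (smeasurable_at (in_tuple ys) (@smeasurable_p _)).
have pp0 ys s : 0 <= (p (ys ++ s))%:E by rewrite lee_fin.
have EgE : (fun ys => Eg (fun x => (calE nu1 nu2 nu3 x ys)%:E) * (h ys)%:E) =
    (fun ys => poisson_int mu w c (fun x => (p (ys ++ x))%:E) * (h ys)%:E).
  by apply/funext => ys; rewrite Eg_calE Epois_poisson_int.
rewrite EgE intYn_iter_wint; last 2 first.
- move=> n; apply: emeasurable_funM; last by apply/measurable_EFinP; exact: mh.
  exact: (@measurable_poisson_int _ _ R mu w mw w0 c _ (n.-tuple (@plate R))
    (fun ys s => (p (ys ++ s))%:E) (@smeasurable_p n)).
- by move=> s; rewrite mule_ge0 ?lee_fin// poisson_int_ge0.
transitivity (Epois B rho b Q V (selsum m (fun s => (h s * p s)%:E))).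
  rewrite /Eg /Egibbs; congr Epois; apply/funext => x.
  rewrite -EFin_selsum -EFinM selsum_mulr// => s r sr.
  by rewrite /p /gibbs_density (nuG_perm _ _ _ sr).
rewrite Epois_poisson_int; last 2 first.
- exact: seqmeasurable_selsum.
- by move=> s; exact: selsum_ge0.
rewrite (@poisson_int_selsum _ _ R mu w mw w0 c c0 m _ mhp hp0).
(* Here [ys] has length exactly [m], so [h (ys ++ s) = h ys] leaves the Poisson integral as a
   constant. *)
apply: eq_iter_wint => ys ysm; rewrite muleC -(@poisson_intZ _ _ R mu w mw w0 c (h ys) _ (mps ys))//.
by congr poisson_int; apply/funext => s; rewrite hm// EFinM.
Qed.

Let seqmeasurable_density f : admissible f -> seqmeasurable (fun s => (f s)%:E * (p s)%:E).
Proof.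
move=> [_ mf] n; apply: emeasurable_funM; last exact: seqmeasurable_p.
by apply/measurable_EFinP; exact: mf.
Qed.

Lemma EgibbsZ (k : R) f : admissible f -> (0 <= k)%R ->
  Eg (fun x => (k * f x)%:E) = k%:E * Eg (fun x => (f x)%:E).
Proof.
move=> af k0; rewrite /Eg /Egibbs.
have mfp := seqmeasurable_density af; have [f0 mf] := af.
have fp0 s : 0 <= (f s)%:E * (p s)%:E by rewrite mule_ge0 ?lee_fin.
rewrite (Epois_poisson_int mfp fp0) -(@poisson_intZ _ _ R mu w mw w0 c k _ mfp)//.
rewrite -Epois_poisson_int.
- by congr Epois; apply/funext => s; rewrite EFinM muleA.
- by move=> n; apply: measurable_funeM; exact: mfp.
- by move=> s; apply: mule_ge0; [rewrite lee_fin|exact: fp0].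
Qed.

Lemma EgibbsD f g : admissible f -> admissible g ->
  Eg (fun x => (f x + g x)%:E) = Eg (fun x => (f x)%:E) + Eg (fun x => (g x)%:E).
Proof.
move=> af ag; rewrite /Eg /Egibbs.
have mfp := seqmeasurable_density af; have mgp := seqmeasurable_density ag.
have [[f0 mf] [g0 mg]] := (af, ag).
have fp0 s : 0 <= (f s)%:E * (p s)%:E by rewrite mule_ge0 ?lee_fin.
have gp0 s : 0 <= (g s)%:E * (p s)%:E by rewrite mule_ge0 ?lee_fin.
rewrite (Epois_poisson_int mfp fp0) (Epois_poisson_int mgp gp0).
rewrite -(@poisson_intD _ _ R mu w mw w0 c _ _ mfp mgp)// -Epois_poisson_int.
- by congr Epois; apply/funext => s; rewrite EFinD ge0_muleDl ?lee_fin.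
- by move=> n; apply: emeasurable_funD; [exact: mfp|exact: mgp].
- by move=> s; apply: adde_ge0; [exact: fp0|exact: gp0].
Qed.

End GibbsMoments.

Theorem theorem5 (R : realType)
  (B : set (@pt R)) (b : R) (rho : @pt R -> R)
  (Q : probability R R) (V : probability (@pt R) R)
  (nu1 nu2 nu3 : R)
  (hBmeas : measurable B)
  (hBbnd : exists M : R, forall z, B z ->
     (`|z.1.1| <= M /\ `|z.1.2| <= M /\ `|z.2| <= M)%R)
  (hBvol : 0 < leb3 B)
  (hb : (0 < b)%R)
  (hrho_meas : measurable_fun setT rho)
  (hrho_ge0 : forall z, (0 <= rho z)%R)
  (hrho_bnd : exists M : R, forall z, (rho z <= M)%R)
  (hQ : Q [set` `]0%R, b]] = 1)
  (hV : V hemisphere = 1)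
  (hnu2 : (nu2 <= 0)%R) (hnu3 : (nu3 <= 0)%R) :
  let Eg := Egibbs B rho b Q V nu1 nu2 nu3 in
  let I := intYn B rho b Q V in
  let E ys := Eg (fun x => (calE nu1 nu2 nu3 x ys)%:E) in
  let y := nthp in
  let l s t := isect_len s t in
  (   Eg (fun x => (Stot x)%:E) =
     I 1%N (fun ys => E ys * (area (y ys 0%N))%R%:E)) /\
  (   Eg (fun x => (Ltot x)%:E) =
     (2^-1)%R%:E * I 2%N (fun ys => E ys * (l (y ys 0%N) (y ys 1%N))%R%:E)) /\
  (   Eg (fun x => (Ntot x)%:E) =
     (6^-1)%R%:E * I 3%N (fun ys => E ys * (tri (y ys 0%N) (y ys 1%N) (y ys 2%N))%R%:E)) /\
  (   Eg (fun x => ((Stot x) ^+ 2)%R%:E) =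
     I 2%N (fun ys => E ys * (area (y ys 0%N) * area (y ys 1%N))%R%:E)
     + I 1%N (fun ys => E ys * ((area (y ys 0%N)) ^+ 2)%R%:E)) /\
  (   Eg (fun x => ((Ltot x) ^+ 2)%R%:E) =
     (4^-1)%R%:E * I 4%N (fun ys => E ys *
         (l (y ys 0%N) (y ys 1%N) * l (y ys 2%N) (y ys 3%N))%R%:E)
     + I 3%N (fun ys => E ys *
         (l (y ys 0%N) (y ys 1%N) * l (y ys 2%N) (y ys 0%N))%R%:E)
     + (2^-1)%R%:E * I 2%N (fun ys => E ys * ((l (y ys 0%N) (y ys 1%N)) ^+ 2)%R%:E)) /\
  (   Eg (fun x => ((Ntot x) ^+ 2)%R%:E) =
     (36^-1)%R%:E * I 6%N (fun ys => E ys *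
         (tri (y ys 0%N) (y ys 1%N) (y ys 2%N) * tri (y ys 3%N) (y ys 4%N) (y ys 5%N))%R%:E)
     + (4^-1)%R%:E * I 5%N (fun ys => E ys *
         (tri (y ys 0%N) (y ys 1%N) (y ys 2%N) * tri (y ys 3%N) (y ys 4%N) (y ys 0%N))%R%:E)
     + (2^-1)%R%:E * I 4%N (fun ys => E ys *
         (tri (y ys 0%N) (y ys 1%N) (y ys 2%N) * tri (y ys 3%N) (y ys 1%N) (y ys 0%N))%R%:E)
     + (6^-1)%R%:E * I 3%N (fun ys => E ys * (tri (y ys 0%N) (y ys 1%N) (y ys 2%N))%R%:E)).
Proof.
move=> Eg I E y l; rewrite /I /E /Eg /y /l => {I E Eg y l}.
have key m h := @Egibbs_selsum R B rho b Q V hBmeas hrho_meas hrho_ge0 nu1 nu2 nu3 m h.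
have addE := @EgibbsD R B rho b Q V hBmeas hrho_meas hrho_ge0 nu1 nu2 nu3.
have scaleE := @EgibbsZ R B rho b Q V hBmeas hrho_meas hrho_ge0 nu1 nu2 nu3.
have aA := @admissible_area R; have aL := @admissible_isect_len R.
have aT := @admissible_tri R; have aS := @admissible_selsum R.
have aX f af := @admissibleM R f f af af; have aM := @admissibleM R; have aZ := @admissibleZ R; have aD := @admissibleD R.
have lC := @isect_lenC R; have tC1 := @triCl R; have tC2 := @triCr R.
(* Each right-hand side is folded back into one Gibbs expectation, which leaves a pointwise identity
   between functions of a configuration. *)
split; [|split; [|split; [|split; [|split]]]].
- rewrite -key//; last by move=> s r sm; rewrite /nthp nth_cat sm.
  congr Egibbs; apply/funext => x.
  by rewrite Stot_sum (sum_selsum dflt_plate).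
- rewrite -key//; last by move=> s r sm; rewrite /nthp !nth_cat sm.
  rewrite -scaleE ?invr_ge0//; last exact: aS.
  congr Egibbs; apply/funext => x.
  by rewrite Ltot_psum (psum_selsum dflt_plate lC).
- rewrite -key//; last by move=> s r sm; rewrite /nthp !nth_cat sm.
  rewrite -scaleE ?invr_ge0//; last exact: aS.
  congr Egibbs; apply/funext => x.
  by rewrite Ntot_tsum (tsum_selsum dflt_plate tC1 tC2).
- have h2 := aM _ _ (aA 0%N) (aA 1%N); have h1 := aX _ (aA 0%N).
  rewrite -(key 2%N _ _ h2); last by move=> s r sm; rewrite /nthp !nth_cat sm.
  rewrite -(key 1%N _ _ h1); last by move=> s r sm; rewrite /nthp !nth_cat sm.
  rewrite -addE; [|exact: aS|exact: aS].
  congr Egibbs; apply/funext => x.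
  by rewrite Stot_sum (sqr_sum_selsum dflt_plate).
- have h4 := aM _ _ (aL 0%N 1%N) (aL 2%N 3%N); have h3 := aM _ _ (aL 0%N 1%N) (aL 2%N 0%N).
  have h2 := aX _ (aL 0%N 1%N).
  rewrite -(key 4%N _ _ h4); last by move=> s r sm; rewrite /nthp !nth_cat sm.
  rewrite -(key 3%N _ _ h3); last by move=> s r sm; rewrite /nthp !nth_cat sm.
  rewrite -(key 2%N _ _ h2); last by move=> s r sm; rewrite /nthp !nth_cat sm.
  have {}h4 := aS 4%N _ h4; have {}h3 := aS 3%N _ h3; have {}h2 := aS 2%N _ h2.
  have i4 : (0 <= 4^-1 :> R)%R by rewrite invr_ge0.
  have i2 : (0 <= 2^-1 :> R)%R by rewrite invr_ge0.
  rewrite -!scaleE// -addE//; last exact: aZ.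
  rewrite -addE; [|by apply/aD => //; exact: aZ|exact: aZ].
  congr Egibbs; apply/funext => x.
  by rewrite Ltot_psum (sqr_psum_selsum dflt_plate lC).
- have h6 := aM _ _ (aT 0%N 1%N 2%N) (aT 3%N 4%N 5%N); have h5 := aM _ _ (aT 0%N 1%N 2%N) (aT 3%N 4%N 0%N).
  have h4 := aM _ _ (aT 0%N 1%N 2%N) (aT 3%N 1%N 0%N); have h3 := aT 0%N 1%N 2%N.
  rewrite -(key 6%N _ _ h6); last by move=> s r sm; rewrite /nthp !nth_cat sm.
  rewrite -(key 5%N _ _ h5); last by move=> s r sm; rewrite /nthp !nth_cat sm.
  rewrite -(key 4%N _ _ h4); last by move=> s r sm; rewrite /nthp !nth_cat sm.
  rewrite -(key 3%N _ _ h3); last by move=> s r sm; rewrite /nthp !nth_cat sm.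
  have {}h6 := aS 6%N _ h6; have {}h5 := aS 5%N _ h5.
  have {}h4 := aS 4%N _ h4; have {}h3 := aS 3%N _ h3.
  have i36 : (0 <= 36^-1 :> R)%R by rewrite invr_ge0.
  have i4 : (0 <= 4^-1 :> R)%R by rewrite invr_ge0.
  have i2 : (0 <= 2^-1 :> R)%R by rewrite invr_ge0.
  have i6 : (0 <= 6^-1 :> R)%R by rewrite invr_ge0.
  have k6 := aZ _ _ i36 h6; have k5 := aZ _ _ i4 h5.
  rewrite -!scaleE//.
  rewrite -addE// -addE; [|exact: aD|exact: aZ].
  rewrite -addE; [|by apply/aD; [exact: aD|exact: aZ]|exact: aZ].
  congr Egibbs; apply/funext => x.
  by rewrite Ntot_tsum (sqr_tsum_selsum dflt_plate tC1 tC2)//; exact: tri_sqr.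
Qed.
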